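(* Let $\mathcal C$ be a finite calculus of finitary rule schemas and $\Lambda$ a finite set of formulas. If $\mathcal C$ is $\Lambda$-analytic, then the problem of deciding, given a B-sequent $\Phi$, whether $\vdash_{\mathcal C}\Phi$, is in $\mathsf{coNP}$.
   Context: Formulas are those of a propositional language over a denumerable set $P$ of variables; substitutions are endomorphisms; $\mathrm{sub}$ gives subformulas. A B-statement is a quadruple $\Phi=(\Phi_{\mathsf A},\Phi_{\overline{\mathsf A}},\Phi_{\mathsf R},\Phi_{\overline{\mathsf R}})$ of sets of formulas, a B-sequent if all four are finite; $\mathrm{sub}(\Phi)=\bigcup_\alpha\mathrm{sub}(\Phi_\alpha)$. A rule schema has antecedent $(\Delta_{\mathsf A},\Delta_{\mathsf R})$ and succedent $(\Delta_{\overline{\mathsf A}},\Delta_{\overline{\mathsf R}})$; finitary if all four sets are finite; instances arise by applying a substitution to all four sets; a calculus is a set of schemas. A derivation is a rooted tree (every branch ends in a leaf) with nodes labelled by pairs $(\Gamma_{\mathsf A},\Gamma_{\mathsf R})$ of sets of formulas or by $\star$, each non-leaf node expanded by an instance of a rule of $\mathcal C$ with $\Delta_{\mathsf A}\subseteq\Gamma_{\mathsf A}$, $\Delta_{\mathsf R}\subseteq\Gamma_{\mathsf R}$: if the succedent is empty its only child is labelled $\star$; otherwise its children are exactly nodes labelled $(\Gamma_{\mathsf A}\cup\{\psi\},\Gamma_{\mathsf R})$, $\psi\in\Delta_{\overline{\mathsf A}}$, and $(\Gamma_{\mathsf A},\Gamma_{\mathsf R}\cup\{\psi\})$, $\psi\in\Delta_{\overline{\mathsf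 R}}$. A proof of $\Phi$ in $\mathcal C$ is a derivation whose root label satisfies $\Gamma_{\mathsf A}\subseteq\Phi_{\mathsf A}$, $\Gamma_{\mathsf R}\subseteq\Phi_{\mathsf R}$ and each of whose leaves is labelled $\star$ or by $(\Gamma'_{\mathsf A},\Gamma'_{\mathsf R})$ with $\Gamma'_{\mathsf A}\cap\Phi_{\overline{\mathsf A}}\ne\emptyset$ or $\Gamma'_{\mathsf R}\cap\Phi_{\overline{\mathsf R}}\ne\emptyset$; $\vdash_{\mathcal C}\Phi$ means a proof exists. $\mathrm{sub}^\Lambda(\Phi)=\mathrm{sub}(\Phi)\cup\{\sigma(\psi):\psi\in\Lambda,\ \sigma\text{ a substitution with }\sigma(P)\subseteq\mathrm{sub}(\Phi)\}$; a proof is $\Lambda$-analytic if all non-$\star$ labels consist of formulas of $\mathrm{sub}^\Lambda(\Phi)$; $\mathcal C$ is $\Lambda$-analytic if every B-statement with a proof in $\mathcal C$ has a $\Lambda$-analytic proof in $\mathcal C$. Input size is the total size of the formulas of $\Phi$. *)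

(* Defs.v *)
From HB Require Import structures.
From Corelib Require Import PosDef.
From Stdlib Require List.
From mathcomp Require Import all_boot.
From mathcomp Require Import boolp classical_sets cardinality.

Set Implicit Arguments.
Unset Strict Implicit.
Unset Printing Implicit Defensive.

Local Open Scope classical_set_scope.

(* Countably many connectives, of arbitrary finite arities. *)
Record signature := Signature { con : countType; ar : con -> nat }.
Arguments ar {s}.

Inductive form (S : signature) : Type :=
| Var of nat
| App (c : con S) of ('I_(ar c) -> form S).
Arguments Var {S}.
Arguments App {S}.

Definition endomorphism (S : signature) (s : form S -> form S) : Prop :=
  forall (c : con S) (a : 'I_(ar c) -> form S),
    s (App c a) = App c (fun i => s (a i)).

Fixpoint sub (S : signature) (f : form S) : set (form S) :=
  match f with
  | Var p => [set Var p]
  | App c a => App c a |` \bigcup_(i in setT) sub (a i)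
  end.

Record bstatement (S : signature) := BStatement {
  accepted : set (form S);
  nonaccepted : set (form S);
  rejected : set (form S);
  nonrejected : set (form S) }.

Definition is_bsequent (S : signature) (Phi : bstatement S) : Prop :=
  [/\ finite_set (accepted Phi), finite_set (nonaccepted Phi),
      finite_set (rejected Phi) & finite_set (nonrejected Phi)].

Definition sub_stmt (S : signature) (Phi : bstatement S) : set (form S) :=
  \bigcup_(f in accepted Phi `|` nonaccepted Phi
                `|` (rejected Phi `|` nonrejected Phi)) sub f.

(* The antecedent is (antA, antR), the succedent is (sucA, sucR). *)
Record schema (S : signature) := Schema {
  antA : set (form S);
  sucA : set (form S);
  antR : set (form S);
  sucR : set (form S) }.

Definition finitary (S : signature) (r : schema S) : Prop :=
  [/\ finite_set (antA r), finite_set (sucA r),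
      finite_set (antR r) & finite_set (sucR r)].

Definition subst_schema (S : signature) (s : form S -> form S) (r : schema S) :=
  Schema (s @` antA r) (s @` sucA r) (s @` antR r) (s @` sucR r).

Definition instances (S : signature) (C : set (schema S)) : set (schema S) :=
  [set r | exists r0 s, [/\ C r0, endomorphism s & r = subst_schema s r0]].

(* [None] is the label [star]. *)
Definition label (S : signature) : Type := option (set (form S) * set (form S)).

(* [derivation C l] is the type of derivations in [C] with root label [l];
   every branch ends in a leaf because the type is inductive. *)
Inductive derivation (S : signature) (C : set (schema S)) : label S -> Type :=
| Leaf l : derivation C l
| Close GA GR r :
    instances C r -> antA r `<=` GA -> antR r `<=` GR ->
    sucA r = set0 /\ sucR r = set0 ->
    derivation C None ->
    derivation C (Some (GA, GR))
| Expand GA GR r :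
    instances C r -> antA r `<=` GA -> antR r `<=` GR ->
    ~ (sucA r = set0 /\ sucR r = set0) ->
    (forall f, sucA r f -> derivation C (Some (GA `|` [set f], GR))) ->
    (forall f, sucR r f -> derivation C (Some (GA, GR `|` [set f]))) ->
    derivation C (Some (GA, GR)).

Fixpoint all_leaves (S : signature) (C : set (schema S)) (Q : label S -> Prop)
    (l : label S) (d : derivation C l) : Prop :=
  match d with
  | Leaf l => Q l
  | Close _ _ _ _ _ _ _ d' => all_leaves Q d'
  | Expand _ _ _ _ _ _ _ dA dR =>
      (forall f h, all_leaves Q (dA f h)) /\ (forall f h, all_leaves Q (dR f h))
  end.

Fixpoint all_labels (S : signature) (C : set (schema S)) (Q : label S -> Prop)
    (l : label S) (d : derivation C l) : Prop :=
  Q l /\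
  match d with
  | Leaf _ => True
  | Close _ _ _ _ _ _ _ d' => all_labels Q d'
  | Expand _ _ _ _ _ _ _ dA dR =>
      (forall f h, all_labels Q (dA f h)) /\ (forall f h, all_labels Q (dR f h))
  end.

Definition closed_label (S : signature) (Phi : bstatement S) (l : label S) :
    Prop :=
  if l is Some (GA, GR) then
    GA `&` nonaccepted Phi !=set0 \/ GR `&` nonrejected Phi !=set0
  else True.

Definition is_proof (S : signature) (C : set (schema S)) (Phi : bstatement S)
    (GA GR : set (form S)) (d : derivation C (Some (GA, GR))) : Prop :=
  [/\ GA `<=` accepted Phi, GR `<=` rejected Phi &
      all_leaves (closed_label Phi) d].

Definition provable (S : signature) (C : set (schema S)) (Phi : bstatement S) :
    Prop :=
  exists GA GR (d : derivation C (Some (GA, GR))), is_proof Phi d.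

(* Substitutions are endomorphisms, and [s (Var p)], [p : nat], are the images
   of the propositional variables. *)
Definition gensub (S : signature) (Lambda : set (form S)) (Phi : bstatement S) :
    set (form S) :=
  sub_stmt Phi `|`
  [set f | exists psi s, [/\ Lambda psi, endomorphism s,
             forall p, sub_stmt Phi (s (Var p)) & f = s psi]].

Definition label_in (S : signature) (X : set (form S)) (l : label S) : Prop :=
  if l is Some (GA, GR) then GA `<=` X /\ GR `<=` X else True.

Definition analytic_provable (S : signature) (Lambda : set (form S))
    (C : set (schema S)) (Phi : bstatement S) : Prop :=
  exists GA GR (d : derivation C (Some (GA, GR))),
    is_proof Phi d /\ all_labels (label_in (gensub Lambda Phi)) d.

Definition analytic (S : signature) (Lambda : set (form S))
    (C : set (schema S)) : Prop :=
  forall Phi : bstatement S, provable C Phi -> analytic_provable Lambda C Phi.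

Variant move := MoveL | Stay | MoveR.

(* [None] is the blank; a machine may use any finite set [W] of symbols besides
   the input alphabet [A] and the certificate alphabet [bool]. *)
Definition symbol (A W : finType) : finType := option (A + (bool + W))%type.

(* Tape 0 is the input tape, tape 1 the certificate tape.  A state [q] halts
   iff [verdict q] is [Some b]; it accepts iff [b = true]. *)
Record machine (A : finType) := Machine {
  state : finType;
  work : finType;
  extra_tapes : nat;
  start : state;
  verdict : state -> option bool;
  delta : state -> {ffun 'I_extra_tapes.+2 -> symbol A work} ->
          state * {ffun 'I_extra_tapes.+2 -> symbol A work * move} }.

(* A two-way infinite tape: [t.1] lists the cells to the left of the head
   (nearest first), [t.2] the scanned cell and those to its right; all cells
   not listed are blank. *)
Definition tape (A W : finType) : Type :=
  seq (symbol A W) * seq (symbol A W).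

Definition tape_read (A W : finType) (t : tape A W) : symbol A W :=
  head None t.2.

Definition tape_update (A W : finType) (t : tape A W)
    (a : symbol A W * move) : tape A W :=
  let: (l, r) := (t.1, a.1 :: behead t.2) in
  match a.2 with
  | MoveL => (behead l, head None l :: r)
  | Stay => (l, r)
  | MoveR => (head None r :: l, behead r)
  end.

Record config (A : finType) (M : machine A) := Config {
  cstate : state M;
  ctapes : 'I_(extra_tapes M).+2 -> tape A (work M) }.

Definition init (A : finType) (M : machine A) (x : seq A) (u : seq bool) :
    config M :=
  Config (start M) (fun i =>
    if i == 0 :> nat then ([::], [seq Some (inl a) | a <- x])
    else if i == 1 :> nat then ([::], [seq Some (inr (inl b)) | b <- u])
    else ([::], [::])).

Definition step (A : finType) (M : machine A) (c : config M) : config M :=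
  if verdict (cstate c) is Some _ then c
  else
    let: (q, act) :=
      delta (cstate c) [ffun i => tape_read (ctapes c i)] in
    Config q (fun i => tape_update (ctapes c i) (act i)).

(* [Some b] if the machine has halted with verdict [b] after at most [t]
   steps. *)
Definition result (A : finType) (M : machine A) (x : seq A) (u : seq bool)
    (t : nat) : option bool :=
  verdict (cstate (iter t (@step A M) (init M x u))).

(* Every polynomial is dominated by some [poly_bound c]. *)
Definition poly_bound (c n : nat) : nat := c * n ^ c + c.

(* A decision problem is given by its set [D] of instances (words over [A]) and
   its set [L `<=` D] of yes-instances: polynomially long certificates checked
   by a deterministic polynomial-time machine. *)
Definition NP_problem (A : finType) (D L : set (seq A)) : Prop :=
  exists (M : machine A) (c : nat),
    (forall x u, D x -> result M x u (poly_bound c (size x + size u)) != None) /\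
    (forall x, D x ->
      (L x <-> exists u, size u <= poly_bound c (size x) /\
                         exists t, result M x u t = Some true)).

(* The complementary problem has the same instances. *)
Definition coNP_problem (A : finType) (D L : set (seq A)) : Prop :=
  NP_problem D (D `\` L).

Definition coNP (A : finType) (L : set (seq A)) : Prop := coNP_problem setT L.

Variant token := Bit of bool | TVar | TOpen | TClose | TSep.

Definition token_code (t : token) : option (option (option (option bool))) :=
  match t with
  | TVar => None | TOpen => Some None | TClose => Some (Some None)
  | TSep => Some (Some (Some None)) | Bit b => Some (Some (Some (Some b)))
  end.

Definition token_decode (o : option (option (option (option bool)))) : token :=
  match o with
  | None => TVar | Some None => TOpen | Some (Some None) => TClose
  | Some (Some (Some None)) => TSep | Some (Some (Some (Some b))) => Bit b
  end.

Lemma token_codeK : cancel token_code token_decode.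
Proof. by case. Qed.

HB.instance Definition _ := Countable.copy token (can_type token_codeK).
HB.instance Definition _ : isFinite token := CanIsFinite token_codeK.

Fixpoint pos_bits (p : positive) : seq token :=
  match p with
  | xH => [::]
  | xO q => Bit false :: pos_bits q
  | xI q => Bit true :: pos_bits q
  end.

(* Binary expansion of [n + 1], least significant digit first, without its
   leading 1: a bijection from [nat] to bit strings. *)
Definition nat_bits (n : nat) : seq token := pos_bits (Pos.of_succ_nat n).

(* Variable and connective indices are written in binary, so the length of the
   word is the size of the formula over a finite alphabet. *)
Fixpoint enc_form (S : signature) (f : form S) : seq token :=
  match f with
  | Var p => TVar :: nat_bits p
  | App c a =>
      TOpen :: nat_bits (pickle c) ++
      flatten [seq enc_form (a i) | i <- enum 'I_(ar c)] ++ [:: TClose]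
  end.

Definition enc_forms (S : signature) (s : seq (form S)) : seq token :=
  flatten [seq enc_form f | f <- s].

Definition lists (S : signature) (s : seq (form S)) (X : set (form S)) : Prop :=
  X = [set f | List.In f s].

(* The finite sets of a B-sequent are written as lists, in any order. *)
Definition encodes (S : signature) (w : seq token) (Phi : bstatement S) : Prop :=
  exists s1 s2 s3 s4 : seq (form S),
    [/\ lists s1 (accepted Phi), lists s2 (nonaccepted Phi),
        lists s3 (rejected Phi), lists s4 (nonrejected Phi)
      & w = enc_forms s1 ++ TSep :: enc_forms s2 ++ TSep ::
            enc_forms s3 ++ TSep :: enc_forms s4].

Definition bsequent_words (S : signature) : set (seq token) :=
  [set w | exists Phi : bstatement S, is_bsequent Phi /\ encodes w Phi].

Definition provable_words (S : signature) (C : set (schema S)) :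
    set (seq token) :=
  [set w | exists Phi : bstatement S,
     [/\ is_bsequent Phi, encodes w Phi & provable C Phi]].

(* Main.v *)
Require Import Defs.
From Corelib Require Import PosDef.
From Stdlib Require Pnat.
From HB Require Import structures.
From mathcomp Require Import all_boot zify.
From mathcomp Require Import boolp classical_sets cardinality.

(** Let X be a finite set of formulas containing sub^Lambda(Phi).  By
    analyticity Phi is unprovable iff there are sets A and R of formulas of X,
    containing the accepted and the rejected formulas of Phi and disjoint from
    the nonaccepted and the nonrejected ones, such that every rule instance with
    antecedent in (A, R) and succedent in X has a succedent formula in (A, R):
    a derivation has a branch that stays inside (A, R), and conversely a maximal
    pair from which Phi is not derivable has this property.

    For X take all substitution instances of subformulas of Lambda by
    subformulas of Phi.  It has polynomial size and is closed under subformulas,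
    so the instances to be tested are those by substitutions into X, and these
    are polynomially many.  The certificate of unprovability is the
    characteristic word of (A, R) on X.

    The verifier operates on binary trees kept on a stack in prefix order, for
    which pairing and projecting push and pop a single symbol. *)

Set Implicit Arguments.
Unset Strict Implicit.
Unset Printing Implicit Defensive.

Local Open Scope classical_set_scope.

(** * A structured language for stack machines and its compiler *)

(** A derivation branches and may be exponentially large, so it is no short witness of provability;
    a refuting pair is merely a subset of a polynomial set. The obstacle is the test of all rule
    instances, since substitutions are arbitrary. If [s f] belongs to a set [X] closed under
    subformulas, then [s] sends every variable of [f] into [X]. As the variables of the rules lie
    below a constant [K], the [K]-tuples over [X] represent all relevant substitutions, and their
    number is polynomial because [K] depends on the calculus and on [Lambda] alone. The instances of
    [Lambda] by themselves need not form a set closed under subformulas, which is why subformulas of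
    [Lambda] are instantiated too. Analyticity serves in one direction only, from a saturated pair
    to unprovability: it keeps the derivation inside [X], where the pair has been tested. In the
    other direction the finiteness of [X] yields a maximal pair. Running times are proved once, for
    closure properties of a class of functions on trees; the verifier is then an ordinary function
    built from these. *)

Definition cell := (token + (bool + void))%type.

(* [RI] and [RC] hold the input and the certificate, [RM] the data; the others
   are empty between two operations. *)
Inductive reg := RI | RC | RM | RA | RB | RD | RN.

Definition idx (r : reg) : 'I_7 :=
  match r with
  | RI => @Ordinal 7 0 isT | RC => @Ordinal 7 1 isT | RM => @Ordinal 7 2 isT
  | RA => @Ordinal 7 3 isT | RB => @Ordinal 7 4 isT | RD => @Ordinal 7 5 isT
  | RN => @Ordinal 7 6 isT
  end.

Lemma idx_inj : injective idx.
Proof. by case; case. Qed.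

Record store := Store {
  sI : seq cell; sC : seq cell; sM : seq cell; sA : seq cell; sB : seq cell;
  sD : seq cell; sN : seq cell }.

Definition get (s : store) (r : reg) : seq cell :=
  match r with
  | RI => sI s | RC => sC s | RM => sM s | RA => sA s | RB => sB s
  | RD => sD s | RN => sN s
  end.

Definition set_reg (s : store) (r : reg) (v : seq cell) : store :=
  let: Store i c m a b d n := s in
  match r with
  | RI => Store v c m a b d n | RC => Store i v m a b d n
  | RM => Store i c v a b d n | RA => Store i c m v b d n
  | RB => Store i c m a v d n | RD => Store i c m a b v n
  | RN => Store i c m a b d v
  end.

Lemma get_set_same s r v : get (set_reg s r v) r = v.
Proof. by case: s; case: r. Qed.

Lemma get_set_other s r r' v : r' <> r -> get (set_reg s r v) r' = get s r'.
Proof. by case: s; case: r; case: r'. Qed.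

Inductive cmd :=
| Skip
| Pop of reg
| Push of reg & reg & (option cell -> cell)
| Seq of cmd & cmd
| If of reg & (option cell -> bool) & cmd & cmd
| While of reg & (option cell -> bool) & cmd.

Notation top s r := (ohead (get s r)).

(* The natural number is the exact number of steps of the compiled machine. *)
Inductive exec : cmd -> store -> nat -> store -> Prop :=
| ExecSkip s : exec Skip s 0 s
| ExecPop r s : exec (Pop r) s 1 (set_reg s r (behead (get s r)))
| ExecPush j i g s :
    exec (Push j i g) s 2 (set_reg s j (g (top s i) :: get s j))
| ExecSeq c1 c2 s1 s2 s3 m n :
    exec c1 s1 m s2 -> exec c2 s2 n s3 -> exec (Seq c1 c2) s1 (m + n) s3
| ExecIfT i (b : option cell -> bool) c1 c2 s s' n :
    b (top s i) -> exec c1 s n s' -> exec (If i b c1 c2) s n.+2 s'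
| ExecIfF i (b : option cell -> bool) c1 c2 s s' n :
    ~~ b (top s i) -> exec c2 s n s' -> exec (If i b c1 c2) s n.+1 s'
| ExecWhileT i (b : option cell -> bool) c s1 s2 s3 m n :
    b (top s1 i) -> exec c s1 m s2 -> exec (While i b c) s2 n s3 ->
    exec (While i b c) s1 (m.+2 + n) s3
| ExecWhileF i (b : option cell -> bool) c s : ~~ b (top s i) -> exec (While i b c) s 1 s.

(* [IJmp i b t] falls through if the test [b] of the top of [i] succeeds. *)
Inductive instr :=
| IPop of reg
| IPush of reg & reg & (option cell -> cell)
| IJmp of reg & (option cell -> bool) & nat.

Fixpoint clen (c : cmd) : nat :=
  match c with
  | Skip => 0 | Pop _ => 1 | Push _ _ _ => 1
  | Seq c1 c2 => clen c1 + clen c2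
  | If _ _ c1 c2 => (clen c1 + (clen c2).+1).+1
  | While _ _ c => (clen c + 1).+1
  end.

(** Jump targets are absolute, so the address [o] of the first instruction is a parameter. The test
    [xpred0] makes a jump unconditional. *)
Fixpoint compile (c : cmd) (o : nat) : seq instr :=
  match c with
  | Skip => [::]
  | Pop r => [:: IPop r]
  | Push j i g => [:: IPush j i g]
  | Seq c1 c2 => compile c1 o ++ compile c2 (o + clen c1)
  | If i b c1 c2 =>
      IJmp i b (o.+1 + clen c1).+1 :: compile c1 o.+1 ++
      IJmp i xpred0 ((o.+1 + clen c1).+1 + clen c2) ::
      compile c2 (o.+1 + clen c1).+1
  | While i b c =>
      IJmp i b (o.+1 + clen c).+1 :: compile c o.+1 ++ [:: IJmp i xpred0 o]
  end.

Lemma size_compile c o : size (compile c o) = clen c.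
Proof.
elim: c o => //= [c1 IH1 c2 IH2|i b c1 IH1 c2 IH2|i b c IH] o;
  by rewrite size_cat /= ?IH1 ?IH2 ?IH.
Qed.

(** * Simulation of compiled programs by a Turing machine *)

Definition sym : finType := symbol token void.
Definition acts := {ffun 'I_7 -> sym * move}.

Definition act (reads : {ffun 'I_7 -> sym}) (r : reg) (a : sym * move) : acts :=
  [ffun k => if k == idx r then a else (reads k, Stay)].

Definition keep (reads : {ffun 'I_7 -> sym}) : acts :=
  [ffun k => (reads k, Stay)].

Section Machine.
Variables (code : seq instr) (final : option cell -> bool).

Definition mstate : finType := ('I_(size code).+1 * sym + bool)%type.

(* The second component of a running state holds the symbol being pushed,
   between the two steps of a push. *)
Definition mdelta (q : mstate) (reads : {ffun 'I_7 -> sym}) : mstate * acts :=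
  match q with
  | inr b => (inr b, keep reads)
  | inl (pc, p) =>
    match onth code pc with
    | None => (inr (final (reads (idx RM))), keep reads)
    | Some (IPop r) => (inl (inord pc.+1, None), act reads r (None, MoveR))
    | Some (IPush j i g) =>
        if p is Some a then (inl (inord pc.+1, None), act reads j (Some a, Stay))
        else (inl (pc, Some (g (reads (idx i)))),
              act reads j (reads (idx j), MoveL))
    | Some (IJmp i b t) =>
        (inl (inord (if b (reads (idx i)) then pc.+1 else t), None), keep reads)
    end
  end.

Definition mach : machine token :=
  @Machine token mstate void 5 (inl (inord 0, None))
    (fun q => if q is inr b then Some b else None) mdelta.

Definition at_pc (pc : nat) (T : 'I_7 -> tape token void) : config mach :=
  @Config token mach (inl (inord pc, None)) T.

(** The head stands on the top of the stack, with blanks on its left. Comparing cells through [nth]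
    makes blanks listed explicitly at the ends of the tape harmless. *)
Definition tape_rep (t : tape token void) (s : seq cell) : Prop :=
  (forall i, nth None t.1 i = None) /\
  (forall i, nth None t.2 i = nth None [seq Some a | a <- s] i).

Definition store_rep (T : 'I_7 -> tape token void) (s : store) : Prop :=
  forall r, tape_rep (T (idx r)) (get s r).

Lemma tape_rep_read t s : tape_rep t s -> tape_read t = ohead s.
Proof. by case=> _ /(_ 0); rewrite /tape_read -nth0 => ->; case: s. Qed.

Lemma tape_rep_keep t s :
  tape_rep t s -> tape_rep (tape_update t (tape_read t, Stay)) s.
Proof.
case: t => l r [hl hr]; split=> // -[|i] /=; rewrite -hr.
  by rewrite /tape_read /= nth0.
by rewrite nth_behead.
Qed.

Lemma tape_rep_pop t s :
  tape_rep t s -> tape_rep (tape_update t (None, MoveR)) (behead s).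
Proof.
case: t => l r [hl hr]; split=> [[|i] //=|i /=].
by rewrite nth_behead hr; case: s {hr} => //= ; rewrite nth_nil.
Qed.

Lemma tape_rep_push t s a : tape_rep t s ->
  tape_rep (tape_update (tape_update t (tape_read t, MoveL)) (Some a, Stay))
           (a :: s).
Proof.
case: t => l r [hl hr]; split=> [i /=|[|[|i]] //=].
- by rewrite nth_behead hl.
- by rewrite -hr /tape_read /= nth0.
by rewrite nth_behead hr.
Qed.

Definition reads_of (T : 'I_7 -> tape token void) : {ffun 'I_7 -> sym} :=
  [ffun i => tape_read (T i)].

Lemma step_at q T :
  step (@Config token mach (inl q) T) =
  let: (q', a) := mdelta (inl q) (reads_of T) in
  @Config token mach q' (fun i => tape_update (T i) (a i)).
Proof. by []. Qed.

Lemma store_rep_keep T s : store_rep T s ->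
  store_rep (fun i => tape_update (T i) (keep (reads_of T) i)) s.
Proof.
by move=> h r; rewrite /keep !ffunE; apply: tape_rep_keep; apply: h.
Qed.

Lemma step_jmp pc i b t T s :
  pc <= size code -> onth code pc = Some (IJmp i b t) -> store_rep T s ->
  exists2 T', store_rep T' s &
    step (at_pc pc T) = at_pc (if b (top s i) then pc.+1 else t) T'.
Proof.
move=> hpc hc hT; eexists; last first.
  rewrite /at_pc step_at /= inordK // hc ffunE (tape_rep_read (hT i)).
  by reflexivity.
exact: store_rep_keep.
Qed.

Lemma step_pop pc r T s :
  pc <= size code -> onth code pc = Some (IPop r) -> store_rep T s ->
  exists2 T', store_rep T' (set_reg s r (behead (get s r))) &
    step (at_pc pc T) = at_pc pc.+1 T'.
Proof.
move=> hpc hc hT; eexists; last first.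
  by rewrite /at_pc step_at /= inordK // hc; reflexivity.
move=> r'; rewrite /act ffunE; case: eqP => [/idx_inj ->|ne].
  by rewrite get_set_same; apply: tape_rep_pop.
rewrite get_set_other; last by move=> e; apply: ne; rewrite e.
by rewrite ffunE; apply: tape_rep_keep.
Qed.

Lemma step_push pc j i g T s :
  pc <= size code -> onth code pc = Some (IPush j i g) -> store_rep T s ->
  exists2 T', store_rep T' (set_reg s j (g (top s i) :: get s j)) &
    iter 2 (@step _ _) (at_pc pc T) = at_pc pc.+1 T'.
Proof.
move=> hpc hc hT; eexists; last first.
  rewrite /= /at_pc step_at /= inordK // hc step_at /=.
  by rewrite inordK // hc; reflexivity.
move=> r'; rewrite /act !ffunE; case: eqP => [/idx_inj ->|ne].
  rewrite get_set_same (tape_rep_read (hT i)).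
  by apply: tape_rep_push.
rewrite get_set_other; last by move=> e; apply: ne; rewrite e.
by do 2! (rewrite ?ffunE; apply: tape_rep_keep).
Qed.

Definition code_at (o : nat) (l : seq instr) : Prop :=
  exists pre post, code = pre ++ l ++ post /\ size pre = o.

Lemma code_at_cat o l1 l2 :
  code_at o (l1 ++ l2) -> code_at o l1 /\ code_at (o + size l1) l2.
Proof.
case=> pre [post [e <-]]; split.
  by exists pre, (l2 ++ post); rewrite e -!catA.
by exists (pre ++ l1), post; rewrite size_cat e -!catA.
Qed.

Lemma code_at_cons o i l :
  code_at o (i :: l) -> onth code o = Some i /\ code_at o.+1 l.
Proof.
case=> pre [post [e <-]]; split.
  by rewrite e onth_cat ltnn subnn.
by exists (rcons pre i), post; rewrite size_rcons cat_rcons.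
Qed.

Lemma code_at_size o l : code_at o l -> o + size l <= size code.
Proof. by case=> pre [post [-> <-]]; rewrite !size_cat; lia. Qed.

Lemma iter_trans m n k (c1 c2 c3 : config mach) : k = m + n ->
  iter m (@step _ _) c1 = c2 -> iter n (@step _ _) c2 = c3 ->
  iter k (@step _ _) c1 = c3.
Proof. by move=> -> e1 e2; rewrite addnC iterD e1. Qed.

(** Induction on the execution rather than on the command: after one round of a loop the backward
    jump returns to address [o], where the second induction hypothesis runs the same code again. *)
Lemma exec_run c s n s' : exec c s n s' ->
  forall o T, code_at o (compile c o) -> store_rep T s ->
  exists2 T', store_rep T' s' &
    iter n (@step _ _) (at_pc o T) = at_pc (o + clen c) T'.
Proof.
elim=> {c s n s'}.
- by move=> s o T _ hT; exists T => //=; rewrite addn0.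
- move=> r s o T hc hT; have := code_at_size hc; rewrite /= addn1 => /ltnW hs.
  by have [hi _] := code_at_cons hc; apply: step_pop.
- move=> j i g s o T hc hT; have := code_at_size hc; rewrite /= addn1 => /ltnW hs.
  by have [hi _] := code_at_cons hc; apply: step_push.
- move=> c1 c2 s1 s2 s3 m n _ IH1 _ IH2 o T /= /code_at_cat[h1 h2] hT.
  have [T1 hT1 e1] := IH1 _ _ h1 hT.
  rewrite size_compile in h2; have [T2 hT2 e2] := IH2 _ _ h2 hT1.
  by exists T2 => //; rewrite (iter_trans erefl e1 e2) addnA.
- move=> i b c1 c2 s s' n hb _ IH o T hc hT.
  have := code_at_size hc; rewrite /= in hc *; rewrite size_cat /= !size_compile => hs.
  have [hi /code_at_cat[h1]] := code_at_cons hc.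
  rewrite size_compile => /code_at_cons[hj _].
  have [|T1 hT1 e1] := step_jmp _ hi hT; first by lia.
  have [T2 hT2 e2] := IH _ _ h1 hT1.
  have [|T3 hT3 e3] := step_jmp _ hj hT2; first by lia.
  rewrite hb in e1; exists T3 => //.
  apply: etrans (iter_trans (m := 1) (esym (add1n _)) e1
            (iter_trans (n := 1) (esym (addn1 _)) e2 e3)) _.
  by congr at_pc; lia.
- move=> i b c1 c2 s s' n hb _ IH o T hc hT.
  have := code_at_size hc; rewrite /= in hc *; rewrite size_cat /= !size_compile => hs.
  have [hi /code_at_cat[_]] := code_at_cons hc.
  rewrite size_compile => /code_at_cons[_ h2].
  have [|T1 hT1 e1] := step_jmp _ hi hT; first by lia.
  have [T2 hT2 e2] := IH _ _ h2 hT1.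
  rewrite (negbTE hb) in e1; exists T2 => //.
  apply: etrans (iter_trans (m := 1) (esym (add1n _)) e1 e2) _.
  by congr at_pc; lia.
- move=> i b c s1 s2 s3 m n hb _ IH1 _ IH2 o T hc hT.
  have := code_at_size hc; have hc' := hc; rewrite /= in hc *.
  rewrite size_cat /= !size_compile => hs.
  have [hi /code_at_cat[h1]] := code_at_cons hc.
  rewrite size_compile => /code_at_cons[hj _].
  have [|T1 hT1 e1] := step_jmp _ hi hT; first by lia.
  have [T2 hT2 e2] := IH1 _ _ h1 hT1.
  have [|T3 hT3 e3] := step_jmp _ hj hT2; first by lia.
  have [T4 hT4 e4] := IH2 _ _ hc' hT3.
  rewrite hb in e1; exists T4 => //.
  have e : m.+2 + n = 1 + (m + (1 + n)) by lia.
  by apply: etrans (iter_trans (m := 1) e e1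
           (iter_trans erefl e2 (iter_trans (m := 1) erefl e3 e4))) _; congr at_pc; lia.
- move=> i b c s hb o T hc hT.
  have := code_at_size hc; rewrite /= size_cat /= !size_compile => hs.
  have [hi _] := code_at_cons hc.
  have [|T1 hT1 e1] := step_jmp _ hi hT; first by lia.
  by rewrite (negbTE hb) in e1; exists T1 => //; rewrite /= e1; congr at_pc; lia.
Qed.
End Machine.

Lemma result_mono (A : finType) (M : machine A) x u t t' b :
  t <= t' -> result M x u t = Some b -> result M x u t' = Some b.
Proof.
move=> /subnK <-; rewrite /result iterD.
elim: (t' - t) => //= k IH /IH h.
by rewrite /step h.
Qed.

Lemma result_det (A : finType) (M : machine A) x u t t' b b' :
  result M x u t = Some b -> result M x u t' = Some b' -> b = b'.
Proof.
move=> h h'; have [le|/ltnW le] := leqP t t'.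
  by have := result_mono le h; rewrite h' => -[].
by have := result_mono le h'; rewrite h => -[].
Qed.

Definition input_store (x : seq token) (u : seq bool) : store :=
  Store [seq inl a | a <- x] [seq inr (inl b) | b <- u] [::] [::] [::] [::] [::].

(** The additional step is the one taken past the end of the code, where the machine enters a
    halting state with the verdict of [final] on the top of [RM]. *)
Lemma exec_result c final x u n s :
  exec c (input_store x u) n s ->
  result (mach (compile c 0) final) x u n.+1 = Some (final (top s RM)).
Proof.
move=> h; have hc : code_at (compile c 0) 0 (compile c 0).
  by exists [::], [::]; rewrite cats0.
have [|T1 hT1 e1] := exec_run final h hc
    (T := ctapes (init (mach (compile c 0) final) x u)).
  by case; split=> i /=; rewrite ?nth_nil -?map_comp.
rewrite /result iterS.
have -> : init (mach (compile c 0) final) x u =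
    at_pc _ _ 0 (ctapes (init (mach (compile c 0) final) x u)) by [].
rewrite e1 /at_pc step_at /= inordK ?size_compile ?leqnn //.
rewrite onth_default ?size_compile //= ffunE.
by rewrite (tape_rep_read (hT1 RM)).
Qed.

(** * Binary trees on stacks and time-bounded runs *)

Inductive data := Nil | Cons of data & data.

HB.instance Definition _ := gen_eqMixin data.

(** A tree is identified with the list of left children along its right spine. This is a bijection,
    so list operations are total on trees and need no error case. *)
Fixpoint undl (d : data) : seq data :=
  if d is Cons a b then a :: undl b else [::].

Fixpoint dl (s : seq data) : data :=
  if s is a :: s' then Cons a (dl s') else Nil.

Lemma dlK : cancel dl undl.
Proof. by elim=> //= a s ->. Qed.

Lemma undlK : cancel undl dl.
Proof. by elim=> //= a _ b ->. Qed.

Definition hd (d : data) : data := if d is Cons a _ then a else Nil.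
Definition tl (d : data) : data := if d is Cons _ b then b else Nil.

Lemma tl_dl s : tl (dl s) = dl (behead s). Proof. by case: s. Qed.

Definition db (b : bool) : data := if b then Cons Nil Nil else Nil.
Definition is_true_d (d : data) : bool := if d is Cons _ _ then true else false.

Lemma dbK : cancel db is_true_d. Proof. by case. Qed.

Definition bc (b : bool) : cell := inr (inl b).
Definition is_bc (b : bool) (o : option cell) : bool := o == Some (bc b).

Fixpoint enc (d : data) : seq cell :=
  if d is Cons a b then bc true :: enc a ++ enc b else [:: bc false].

Definition sz (d : data) : nat := size (enc d).

Lemma sz_Cons a b : sz (Cons a b) = (sz a + sz b).+1.
Proof. by rewrite /sz /= size_cat. Qed.

(** The prefix code is self-delimiting: a tree can be cut off the top of a stack without an end
    marker. *)
Lemma enc_inj a b r r' : enc a ++ r = enc b ++ r' -> a = b /\ r = r'.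
Proof.
elim: a b r r' => [|a1 IH1 a2 IH2] [|b1 b2] r r' //=; first by case.
by case; rewrite -!catA => /IH1[-> /IH2[-> ->]].
Qed.

Lemma sz_dl s : sz (dl s) = (sumn [seq (sz a).+1 | a <- s]).+1.
Proof. by elim: s => //= a s IH; rewrite sz_Cons IH; lia. Qed.

Lemma size_le_sz d : size (undl d) <= sz d.
Proof. by elim: d => //= a _ b IH; rewrite sz_Cons; lia. Qed.

Lemma sz_mem a d : a \in undl d -> sz a <= sz d.
Proof.
elim: d => //= b _ c IH; rewrite inE sz_Cons => /orP[/eqP->|/IH]; lia.
Qed.

Definition runs (c : cmd) (s s' : store) (t : nat) : Prop :=
  exists2 n, n <= t & exec c s n s'.

Lemma runs_le c s s' t t' : t <= t' -> runs c s s' t -> runs c s s' t'.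
Proof. by move=> h [n hn e]; exists n => //; apply: leq_trans hn h. Qed.

Lemma runs_skip s t : runs Skip s s t.
Proof. by exists 0 => //; constructor. Qed.

Lemma runs_pop r s s' : s' = set_reg s r (behead (get s r)) -> runs (Pop r) s s' 1.
Proof. by move=> ->; exists 1 => //; constructor. Qed.

Lemma runs_push j i g s s' :
  s' = set_reg s j (g (top s i) :: get s j) -> runs (Push j i g) s s' 2.
Proof. by move=> ->; exists 2 => //; constructor. Qed.

Lemma runs_seq c1 c2 s1 s2 s3 m n :
  runs c1 s1 s2 m -> runs c2 s2 s3 n -> runs (Seq c1 c2) s1 s3 (m + n).
Proof.
move=> [m' hm e1] [n' hn e2]; exists (m' + n'); first exact: leq_add.
exact: ExecSeq e1 e2.
Qed.

Lemma runs_if i b c1 c2 s s' n :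
  runs (if b (top s i) then c1 else c2) s s' n -> runs (If i b c1 c2) s s' n.+2.
Proof.
case=> m hm; case: ifP => hb e.
  by exists m.+2 => //; apply: ExecIfT.
by exists m.+1; [lia | apply: ExecIfF; rewrite ?hb].
Qed.

Lemma runs_whileT i (b : option cell -> bool) c s1 s2 s3 m n : b (top s1 i) ->
  runs c s1 s2 m -> runs (While i b c) s2 s3 n -> runs (While i b c) s1 s3 (m.+2 + n).
Proof.
move=> hb [m' hm e1] [n' hn e2]; exists (m'.+2 + n'); first by lia.
exact: ExecWhileT e1 e2.
Qed.

Lemma runs_whileF i (b : option cell -> bool) c s : ~~ b (top s i) ->
  runs (While i b c) s s 1.
Proof. by move=> hb; exists 1 => //; apply: ExecWhileF. Qed.

Definition ms (m : seq cell) : store := Store [::] [::] m [::] [::] [::] [::].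

Definition nonempty (o : option cell) : bool := isSome o.
Definition copy (o : option cell) : cell := odflt (bc false) o.
Definition const_cell (a : cell) : option cell -> cell := fun=> a.
Notation PushC r a := (Push r r (const_cell a)).

Definition aux (r : reg) : bool :=
  match r with RA | RB | RD => true | _ => false end.

(* [RN] is a unary counter of the values that remain to be moved. *)
Definition move_loop (r : reg) : cmd :=
  While RN nonempty
    (Seq (Push r RM copy)
      (Seq (If RM (is_bc true) (PushC RN (bc true)) (Pop RN)) (Pop RM))).

Definition move_to (r : reg) : cmd := Seq (PushC RN (bc true)) (move_loop r).

(** Stated with a continuation, because the loop is still running when one subtree has been moved:
    the hypothesis is the run of the loop on what remains. A cell costs at most 9 steps: 2 for the
    loop, 2 for the push, 4 for the counter and 1 for the pop. *)
Lemma runs_move_loop r x m k s t s' :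
  aux r -> get s RM = enc x ++ m -> get s RN = nseq k.+1 (bc true) ->
  runs (move_loop r)
    (set_reg (set_reg (set_reg s RM m) RN (nseq k (bc true))) r
       (catrev (enc x) (get s r))) s' t ->
  runs (move_loop r) s s' (9 * sz x + t).
Proof.
elim: x m k s t => [|a IHa b IHb] m k s t hr hM hN h.
  apply: runs_le (runs_whileT (m := 7) (n := t) _ _ h); first by rewrite /sz /=; lia.
    by rewrite hN.
  apply: (@runs_le _ _ _ (2 + (3 + 1))) => //.
  apply: runs_seq; first exact: runs_push.
  apply: (runs_seq (s2 := set_reg (set_reg s r (bc false :: get s r)) RN
     (nseq k (bc true)))); first apply: runs_if.
    by case: s r hr hM hN {h} => i c m' a b d n [] //= _ -> ? /=; subst; apply: runs_pop.
  by case: s r hr hM hN {h} => i c m' a b d n [] //= _ -> ? /=; subst; apply: runs_pop.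
rewrite sz_Cons.
apply: (@runs_le _ _ _ (7.+2 + (9 * sz a + (9 * sz b + t)))); first by lia.
apply: (runs_whileT (s2 := set_reg (set_reg (set_reg s RM (enc a ++ enc b ++ m)) RN (nseq k.+2 (bc true))) r
   (bc true :: get s r))).
- by rewrite hN.
- apply: (@runs_le _ _ _ (2 + (4 + 1))) => //.
  apply: runs_seq; first exact: runs_push.
  apply: (runs_seq (s2 := set_reg (set_reg s r (bc true :: get s r)) RN
     (nseq k.+2 (bc true)))); first apply: runs_if.
    by case: s r hr hM hN {h IHa IHb} => i c m' a' b' d n [] //= _ -> ? /=; subst; apply: runs_push.
  by case: s r hr hM hN {h IHa IHb} => i c m' a' b' d n [] //= _ -> ? /=; subst; apply: runs_pop;
    rewrite /= -catA.
apply: (IHa (enc b ++ m) k.+1) => //.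
- by case: s r hr {hM hN h IHa IHb} => i c m' a' b' d n [].
- by case: s r hr {hM hN h IHa IHb} => i c m' a' b' d n [].
apply: (IHb m k) => //.
- by case: s r hr {hM hN h IHa IHb} => i c m' a' b' d n [].
- by case: s r hr {hM hN h IHa IHb} => i c m' a' b' d n [].
move: h; rewrite /= catrev_catl.
by case: s r hr {hM hN IHa IHb} => i c m' a' b' d n [].
Qed.

Lemma runs_move r x m s s' : aux r -> get s RM = enc x ++ m -> get s RN = [::] ->
  s' = set_reg (set_reg s RM m) r (catrev (enc x) (get s r)) ->
  runs (move_to r) s s' (9 * sz x + 3).
Proof.
move=> hr hM hN ->; apply: (@runs_le _ _ _ (2 + (9 * sz x + 1))); first by lia.
apply: runs_seq; first exact: runs_push.
apply: (@runs_move_loop r x m 0) => //=.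
- by case: s r hr hM hN => i c m' a' b' d n [].
- by case: s r hr hM hN => i c m' a' b' d n [] //= _ _ ->.
set s1 := set_reg s RN _.
have -> : set_reg (set_reg (set_reg s1 RM m) RN [::]) r (catrev (enc x) (get s1 r)) =
    set_reg (set_reg s RM m) r (catrev (enc x) (get s r)).
  rewrite /s1 {s1}.
  by case: s r hr hM hN => i c m' a' b' d n [] //= _ _ ->.
apply: runs_whileF; clear s1.
by case: s r hr hM hN => i c m' a' b' d n [] //= _ _ ->.
Qed.

Definition transfer (r r' : reg) : cmd :=
  While r nonempty (Seq (Push r' r copy) (Pop r)).

Lemma runs_transfer r r' v s s' : r <> r' -> get s r = v ->
  s' = set_reg (set_reg s r [::]) r' (catrev v (get s r')) ->
  runs (transfer r r') s s' (5 * size v + 1).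
Proof.
move=> ne; elim: v s s' => [|a v IH] s s' hv ->.
  have -> : set_reg (set_reg s r [::]) r' (catrev [::] (get s r')) = s.
    by case: s r r' ne hv => i c m a b d n [] [] //= _ ->.
  by apply: runs_whileF; rewrite hv.
apply: (@runs_le _ _ _ (3.+2 + (5 * size v + 1))); first by rewrite /=; lia.
apply: (runs_whileT (s2 := set_reg (set_reg s r v) r' (a :: get s r'))).
- by rewrite hv.
- apply: (@runs_le _ _ _ (2 + 1)) => //.
  apply: runs_seq; first exact: runs_push.
  by apply: runs_pop; case: s r r' ne hv {IH} => i c m x b d n [] [] //= _ ->.
by apply: IH; case: s r r' ne hv => i c m x b d n [] [] //= _ ->.
Qed.

Definition clear (r : reg) : cmd := While r nonempty (Pop r).

Lemma runs_clear r v s s' : get s r = v -> s' = set_reg s r [::] ->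
  runs (clear r) s s' (3 * size v + 1).
Proof.
elim: v s s' => [|a v IH] s s' hv ->.
  have -> : set_reg s r [::] = s.
    by case: s r hv => i c m a b d n [] //= ->.
  by apply: runs_whileF; rewrite hv.
apply: (@runs_le _ _ _ (1.+2 + (3 * size v + 1))); first by rewrite /=; lia.
apply: (runs_whileT (s2 := set_reg s r v)).
- by rewrite hv.
- by apply: runs_pop; rewrite hv.
by apply: IH; case: s r hv => i c m x b d n [].
Qed.

(** * Polynomial bounds and operations on the main stack *)

Definition pbound (b : nat -> nat) : Prop :=
  exists c, forall n, b n <= poly_bound c n.

Lemma leq_poly_bound c c' n n' :
  c <= c' -> n <= n' -> poly_bound c n <= poly_bound c' n'.
Proof.
move=> hc hn; rewrite /poly_bound leq_add //; case: c hc => // c hc.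
apply: leq_mul => //; apply: (@leq_trans (n ^ c')).
  by case: n {hn} => [|n]; [rewrite exp0n | rewrite leq_pexp2l].
by rewrite leq_exp2r //; apply: leq_trans hc.
Qed.

Lemma pb_le b b' : (forall n, b n <= b' n) -> pbound b' -> pbound b.
Proof. by move=> h [c hc]; exists c => n; apply: leq_trans (h n) (hc n). Qed.

Lemma pb_const k : pbound (fun=> k).
Proof. by exists k => n; rewrite /poly_bound leq_addl. Qed.

Lemma pb_id : pbound id.
Proof. by exists 1 => n; rewrite /poly_bound mul1n expn1 leq_addr. Qed.

Lemma pb_add b1 b2 : pbound b1 -> pbound b2 -> pbound (fun n => b1 n + b2 n).
Proof.
move=> [c1 h1] [c2 h2]; exists (c1 + c2) => n.
apply: leq_trans (leq_add (h1 n) (h2 n)) _; rewrite /poly_bound.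
rewrite addnACA leq_add2r mulnDl leq_add //.
  case: c1 {h1} => // c1; rewrite leq_mul2l /=.
  by case: n => [|n]; [rewrite exp0n | rewrite leq_pexp2l ?leq_addr].
case: c2 {h2} => // c2; rewrite leq_mul2l /=.
by case: n => [|n]; [rewrite exp0n | rewrite leq_pexp2l ?leq_addl].
Qed.

(** The product is [c1 * c2] times four monomials of degree at most [c1 + c2]; the new constant is
    large enough both as coefficient and as exponent. The case [n = 0] is separate, since powers of
    0 do not increase with the exponent. *)
Lemma pb_mul b1 b2 : pbound b1 -> pbound b2 -> pbound (fun n => b1 n * b2 n).
Proof.
move=> [c1 h1] [c2 h2]; exists (4 * (c1 * c2) + (c1 + c2)) => n.
apply: leq_trans (leq_mul (h1 n) (h2 n)) _; rewrite /poly_bound.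
case: n {h1 h2} => [|n].
  case: c1 => [|c1]; first by rewrite !mul0n.
  case: c2 => [|c2]; first by rewrite !mul0n !muln0.
  by rewrite !exp0n ?muln0 ?add0n //; lia.
have h1 : n.+1 ^ c1 <= n.+1 ^ (4 * (c1 * c2) + (c1 + c2)).
  by rewrite leq_pexp2l //; lia.
have h2 : n.+1 ^ c2 <= n.+1 ^ (4 * (c1 * c2) + (c1 + c2)).
  by rewrite leq_pexp2l //; lia.
have h3 : n.+1 ^ c1 * n.+1 ^ c2 <= n.+1 ^ (4 * (c1 * c2) + (c1 + c2)).
  by rewrite -expnD leq_pexp2l //; lia.
have h4 : 0 < n.+1 ^ (4 * (c1 * c2) + (c1 + c2)) by rewrite expn_gt0.
move: (n.+1 ^ c1) (n.+1 ^ c2) (n.+1 ^ (4 * (c1 * c2) + (c1 + c2))) h1 h2 h3 h4 => x y z h1 h2 h3 h4.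
have -> : (c1 * x + c1) * (c2 * y + c2) = c1 * c2 * (x * y + x + y + 1) by lia.
have : c1 * c2 * (x * y + x + y + 1) <= c1 * c2 * (4 * z).
  by apply: leq_mul => //; lia.
by lia.
Qed.

Lemma pb_pow b k : pbound b -> pbound (fun n => b n ^ k).
Proof.
move=> h; elim: k => [|k IH]; first exact: pb_const.
apply: pb_le (pb_mul h IH) => n; by rewrite expnS.
Qed.

Lemma pb_comp c b : pbound b -> pbound (fun n => poly_bound c (b n)).
Proof.
move=> h; apply: pb_add (pb_const _).
by apply: pb_mul; [apply: pb_const | apply: pb_pow].
Qed.

Ltac pb := repeat first
  [ exact: pb_id | exact: pb_const
  | match goal with
    | |- pbound (fun n => @?f n + @?g n) => apply: (@pb_add f g)
    | |- pbound (fun n => @?f n * @?g n) => apply: (@pb_mul f g)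
    | |- pbound (fun n => poly_bound ?c (@?f n)) => apply: (@pb_comp c f)
    end ].

Definition drop_top : cmd := Seq (move_to RA) (clear RA).

Lemma runs_drop x r : runs drop_top (ms (enc x ++ r)) (ms r) (12 * sz x + 4).
Proof.
apply: (@runs_le _ _ _ ((9 * sz x + 3) + (3 * size (rev (enc x)) + 1))).
  by rewrite size_rev -/(sz x); lia.
apply: runs_seq; first exact: (runs_move (m := r)).
by apply: runs_clear.
Qed.

Definition move_back (r : reg) : cmd := transfer r RM.

Lemma runs_back r x m s s' : aux r -> get s r = rev (enc x) -> get s RM = m ->
  s' = set_reg (set_reg s r [::]) RM (enc x ++ m) ->
  runs (move_back r) s s' (5 * sz x + 1).
Proof.
move=> hr hx hm ->; have -> : sz x = size (rev (enc x)) by rewrite size_rev.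
apply: runs_transfer => //; first by move=> e; rewrite e in hr.
by rewrite hm catrevE revK.
Qed.

Definition dup_loop : cmd :=
  While RA nonempty (Seq (Push RM RA copy) (Seq (Push RB RA copy) (Pop RA))).

Lemma runs_dup_loop v m b :
  runs dup_loop (Store [::] [::] m v b [::] [::])
    (Store [::] [::] (catrev v m) [::] (catrev v b) [::] [::]) (7 * size v + 1).
Proof.
elim: v m b => [|a v IH] m b; first exact: runs_whileF.
apply: (@runs_le _ _ _ (5.+2 + (7 * size v + 1))); first by rewrite /=; lia.
apply: runs_whileT (IH (a :: m) (a :: b)) => //.
apply: (@runs_le _ _ _ (2 + (2 + 1))) => //.
apply: runs_seq; first exact: runs_push.
by apply: runs_seq; [exact: runs_push | exact: runs_pop].
Qed.

(** The copy left in [RB] is in direct order and takes a detour through [RA], since emptying a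
    register onto [RM] reverses it. *)
Definition dup_top : cmd :=
  Seq (move_to RA) (Seq dup_loop (Seq (transfer RB RA) (move_back RA))).

Lemma runs_dup x r :
  runs dup_top (ms (enc x ++ r)) (ms (enc x ++ enc x ++ r)) (26 * sz x + 6).
Proof.
apply: (@runs_le _ _ _ ((9 * sz x + 3) + ((7 * size (rev (enc x)) + 1) +
  ((5 * size (enc x) + 1) + (5 * sz x + 1))))).
  by rewrite size_rev -!/(sz x); lia.
apply: runs_seq; first exact: (runs_move (m := r)).
apply: runs_seq; first by apply: runs_dup_loop.
rewrite /= !catrevE !cats0 !revK.
apply: runs_seq; first by apply: runs_transfer.
by apply: runs_back; rewrite //= catrevE cats0.
Qed.

Definition swap_top : cmd :=
  Seq (move_to RA) (Seq (move_to RB) (Seq (move_back RA) (move_back RB))).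

Lemma runs_swap x y r :
  runs swap_top (ms (enc x ++ enc y ++ r)) (ms (enc y ++ enc x ++ r))
    (14 * (sz x + sz y) + 8).
Proof.
apply: (@runs_le _ _ _ ((9 * sz x + 3) + ((9 * sz y + 3) +
  ((5 * sz x + 1) + (5 * sz y + 1))))); first by lia.
apply: runs_seq; first exact: (runs_move (m := enc y ++ r)).
apply: runs_seq; first exact: (runs_move (m := r)).
apply: runs_seq; first by apply: runs_back; rewrite //= catrevE cats0.
by apply: runs_back; rewrite //= catrevE cats0.
Qed.

Definition rot_top : cmd :=
  Seq (move_to RA) (Seq (move_to RB) (Seq (move_to RD)
  (Seq (move_back RB) (Seq (move_back RD) (move_back RA))))).

Lemma runs_rot x y z r :
  runs rot_top (ms (enc x ++ enc y ++ enc z ++ r))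
    (ms (enc x ++ enc z ++ enc y ++ r)) (14 * (sz x + sz y + sz z) + 12).
Proof.
apply: (@runs_le _ _ _ ((9 * sz x + 3) + ((9 * sz y + 3) + ((9 * sz z + 3) +
  ((5 * sz y + 1) + ((5 * sz z + 1) + (5 * sz x + 1))))))); first by lia.
apply: runs_seq; first exact: (runs_move (m := enc y ++ enc z ++ r)).
apply: runs_seq; first exact: (runs_move (m := enc z ++ r)).
apply: runs_seq; first exact: (runs_move (m := r)).
apply: runs_seq; first by apply: runs_back; rewrite //= catrevE cats0.
apply: runs_seq; first by apply: runs_back; rewrite //= catrevE cats0.
by apply: runs_back; rewrite //= catrevE cats0.
Qed.

(* Pops [RA] and [RB] in parallel, leaving a mark on [RD] at each mismatch. *)
Definition cmp_loop : cmd :=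
  While RA nonempty
    (Seq (If RA (is_bc true)
            (If RB (is_bc true) Skip (PushC RD (bc true)))
            (If RB (is_bc false) Skip (PushC RD (bc true))))
      (Seq (Pop RA) (Pop RB))).

Lemma runs_cmp_loop (v w : seq bool) m (d : seq cell) :
  exists2 d' : seq cell, runs cmp_loop (Store [::] [::] m (map bc v) (map bc w) d [::])
    (Store [::] [::] m [::] (map bc (drop (size v) w)) d' [::])
    (10 * size v + 1) /\ size d' <= size d + size v &
    nilp d' = nilp d && (v == take (size v) w).
Proof.
elim: v w d => [|a v IH] w d.
  by exists d; rewrite ?drop0 ?take0 ?andbT ?addn0 //; split=> //; apply: runs_whileF.
pose e := if ohead w == Some a then d else bc true :: d.
have [d' [h hd] hd'] := IH (behead w) e.
exists d'; last first.
  rewrite hd' /e; case: w {IH h hd e hd'} => [|b w] /=.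
    by rewrite andbF.
  rewrite eqseq_cons [Some b == _]eq_sym; case: eqP => [[->]|ne] //=.
    by rewrite eqxx.
  by case: eqP => [ab|]; [rewrite ab in ne | rewrite andbF].
split; last first.
  by apply: leq_trans hd _; rewrite /e; case: ifP => _ /=; lia.
apply: (@runs_le _ _ _ (8.+2 + (10 * size v + 1))); first by rewrite /=; lia.
have -> : drop (size (a :: v)) w = drop (size v) (behead w) by case: w {IH h hd e hd'}; case: v.
apply: runs_whileT h => //.
apply: (@runs_le _ _ _ ((2.+2).+2 + (1 + 1))) => //.
apply: (runs_seq (s2 := Store [::] [::] m (map bc (a :: v)) (map bc w) e [::])).
  rewrite /e; case: w {IH hd e hd'} => [|[] w]; case: a; apply: runs_if; apply: runs_if;
    first [exact: runs_push | exact: runs_skip].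
apply: runs_seq; first exact: runs_pop.
by apply: runs_pop; rewrite /= behead_map.
Qed.

Fixpoint encb (d : data) : seq bool :=
  if d is Cons a b then true :: encb a ++ encb b else [:: false].

Lemma enc_encb d : enc d = map bc (encb d).
Proof. by elim: d => //= a -> b ->; rewrite map_cat. Qed.

(** Leftover cells in [RB] mean that the second code is longer, marks in [RD] that a mismatch
    occurred. The first cell pushed is the code of [db false]; two more cells complete it to
    [db true]. *)
Definition eq_top : cmd :=
  Seq (move_to RA) (Seq (move_to RB) (Seq cmp_loop
    (Seq (PushC RM (bc false))
    (Seq (If RB nonempty Skip
       (If RD nonempty Skip
         (Seq (PushC RM (bc false)) (PushC RM (bc true)))))
    (Seq (clear RB) (clear RD)))))).

Lemma eq_rev_enc x y :
  (x == y) = nilp (drop (size (rev (encb x))) (rev (encb y))) &&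
             (rev (encb x) == take (size (rev (encb x))) (rev (encb y))).
Proof.
apply/eqP/andP => [->|[h1 /eqP h2]]; first by rewrite drop_size take_size eqxx.
have h : rev (encb x) = rev (encb y).
  by rewrite -[RHS](cat_take_drop (size (rev (encb x)))) -h2 (nilP h1) cats0.
have [] // := @enc_inj x y [::] [::].
by rewrite !enc_encb; have := congr1 rev h; rewrite !revK => ->.
Qed.

Lemma runs_eq x y r :
  runs eq_top (ms (enc x ++ enc y ++ r)) (ms (enc (db (x == y)) ++ r))
    (30 * (sz x + sz y) + 30).
Proof.
have hx : size (rev (encb x)) = sz x by rewrite size_rev /sz enc_encb size_map.
have hy : size (rev (encb y)) = sz y by rewrite size_rev /sz enc_encb size_map.
have [d [hd sd] nd] := runs_cmp_loop (rev (encb x)) (rev (encb y)) r [::].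
set dd := drop _ _ in hd.
apply: (@runs_le _ _ _ ((9 * sz x + 3) + ((9 * sz y + 3) + ((10 * sz x + 1) +
  (2 + (8 + ((3 * size (map bc dd) + 1) + (3 * size d + 1)))))))).
  by rewrite size_map /dd size_drop; move: sd; rewrite hx hy /= ; lia.
apply: runs_seq; first exact: (runs_move (m := enc y ++ r)).
apply: runs_seq; first exact: (runs_move (m := r)).
rewrite hx in hd.
apply: runs_seq; first by rewrite /= !catrevE !cats0 !enc_encb -!map_rev; exact: hd.
apply: runs_seq; first exact: runs_push.
apply: (runs_seq (s2 := Store [::] [::] (enc (db (x == y)) ++ r) [::] (map bc dd) d [::])).
  rewrite eq_rev_enc -/dd; rewrite /= in nd; rewrite -nd.
  apply: runs_if; case: dd {hd} => [|a dd] /=; last exact: runs_skip.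
  apply: runs_if; case: d {nd sd} => [|b d] /=; last exact: runs_skip.
  by apply: (@runs_le _ _ _ (2 + 2)) => //; apply: runs_seq; exact: runs_push.
apply: runs_seq; first by apply: runs_clear.
by apply: runs_clear.
Qed.

(** * Polynomial-time functions on binary trees *)

(** The rest [r] of the stack is arbitrary and preserved, so that intermediate results can wait
    below the argument. The size of the result is bounded too, as composition requires it. *)
Definition computes (P : cmd) (f : data -> data) (c : nat) : Prop :=
  forall x, sz (f x) <= poly_bound c (sz x) /\
    forall r, runs P (ms (enc x ++ r)) (ms (enc (f x) ++ r)) (poly_bound c (sz x)).

Definition FP (f : data -> data) : Prop := exists P c, computes P f c.

Lemma FP_intro f P b : pbound b ->
  (forall x, sz (f x) <= b (sz x) /\
     forall r, runs P (ms (enc x ++ r)) (ms (enc (f x) ++ r)) (b (sz x))) -> FP f.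
Proof.
move=> [c hc] h; exists P, c => x; have [h1 h2] := h x.
split; first exact: leq_trans h1 (hc _).
by move=> r; apply: runs_le (hc _) (h2 r).
Qed.

Lemma FP_size f : FP f -> exists c, forall x, sz (f x) <= poly_bound c (sz x).
Proof. by case=> P [c h]; exists c => x; have [] := h x. Qed.

Lemma eq_FP f g : f =1 g -> FP f -> FP g.
Proof. by move=> /funext ->. Qed.

Lemma FP_id : FP id.
Proof.
apply: (FP_intro (P := Skip) pb_id) => x; split=> // r; exact: runs_skip.
Qed.

Lemma FP_comp f g : FP f -> FP g -> FP (fun x => f (g x)).
Proof.
move=> [P [c hf]] [Q [d hg]].
apply: (@FP_intro _ (Seq Q P) (fun n => poly_bound d n + poly_bound c (poly_bound d n))).
  by apply: pb_add; [exists d | apply: pb_comp; exists d].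
move=> x; have [sg rg] := hg x; have [sf rf] := hf (g x).
have h : poly_bound c (sz (g x)) <= poly_bound c (poly_bound d (sz x)).
  exact: leq_poly_bound.
split=> [|r]; first by apply: leq_trans sf (leq_trans h (leq_addl _ _)).
by apply: runs_seq (rg r) _; apply: runs_le h (rf r).
Qed.

Definition push_data (v : seq cell) : cmd :=
  foldr (fun a c => Seq c (PushC RM a)) Skip v.

Lemma runs_push_store v s :
  runs (push_data v) s (set_reg s RM (v ++ get s RM)) (2 * size v).
Proof.
elim: v => [|a v IH].
  by have -> : set_reg s RM ([::] ++ get s RM) = s; [case: s | exact: runs_skip].
rewrite [size _]/= mulnS addnC; apply: runs_seq IH _.
by apply: runs_push; case: s.
Qed.

Lemma runs_push_data v m : runs (push_data v) (ms m) (ms (v ++ m)) (2 * size v).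
Proof. exact: runs_push_store. Qed.

Lemma FP_const d : FP (fun=> d).
Proof.
apply: (@FP_intro _ (Seq drop_top (push_data (enc d)))
  (fun n => 12 * n + 4 + 2 * sz d)); first by pb.
move=> x; split=> [|r]; first by lia.
by apply: runs_seq (runs_drop x r) _; apply: runs_push_data.
Qed.

Lemma FP_Cons f g : FP f -> FP g -> FP (fun x => Cons (f x) (g x)).
Proof.
move=> [P [c hf]] [Q [d hg]].
apply: (@FP_intro _ (Seq dup_top (Seq Q (Seq swap_top (Seq P (PushC RM (bc true))))))
  (fun n => 26 * n + 6 + (poly_bound d n + (14 * (poly_bound d n + n) + 8 +
     (poly_bound c n + 2))))).
  by pb.
move=> x; have [sg rg] := hg x; have [sf rf] := hf x; split=> [|r].
  by rewrite sz_Cons; lia.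
apply: runs_seq (runs_dup x r) _.
apply: runs_seq (rg _) _.
apply: runs_seq; first by apply: runs_le (runs_swap _ _ _); lia.
apply: runs_seq (rf _) _.
by apply: runs_push; rewrite /= -catA.
Qed.

Lemma FP_hd f : FP f -> FP (fun x => hd (f x)).
Proof.
apply: FP_comp.
apply: (@FP_intro _ (If RM (is_bc true) (Seq (Pop RM) (Seq swap_top drop_top)) Skip)
  (fun n => 1 + (14 * n + 8 + (12 * n + 4)) + 2)); first by pb.
case=> [|a b]; first by split=> // r; apply: runs_le (runs_if (n := 0) _) => //; exact: runs_skip.
rewrite sz_Cons; split=> [|r]; first by rewrite /=; lia.
rewrite addn2; apply: runs_if => /=; rewrite -catA.
apply: runs_seq; first exact: runs_pop.
apply: (runs_seq (s2 := ms (enc b ++ enc a ++ r))).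
  by apply: runs_le (runs_swap _ _ _); lia.
by apply: runs_le (runs_drop _ _); lia.
Qed.

Lemma FP_tl f : FP f -> FP (fun x => tl (f x)).
Proof.
apply: FP_comp.
apply: (@FP_intro _ (If RM (is_bc true) (Seq (Pop RM) drop_top) Skip)
  (fun n => 1 + (12 * n + 4) + 2)); first by pb.
case=> [|a b]; first by split=> // r; apply: runs_le (runs_if (n := 0) _) => //; exact: runs_skip.
rewrite sz_Cons; split=> [|r]; first by rewrite /=; lia.
rewrite addn2; apply: runs_if => /=; rewrite -catA.
apply: runs_seq; first exact: runs_pop.
by apply: runs_le (runs_drop _ _); lia.
Qed.

Lemma FP_eq f g : FP f -> FP g -> FP (fun x => db (f x == g x)).
Proof.
move=> hf hg; have := FP_comp _ (FP_Cons hf hg); move/(_ (fun z => db (hd z == tl z))).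
apply.
(* On [Nil] both projections are [Nil], hence the constant answer [db true] in the second branch. *)
apply: (@FP_intro _ (If RM (is_bc true) (Seq (Pop RM) eq_top)
    (Seq drop_top (push_data (enc (db true)))))
  (fun n => 1 + (30 * n + 30) + 2)); first by pb.
case=> [|a b]; rewrite ?sz_Cons; (split=> [|r]; first by case: (_ == _); rewrite /= /sz /=; lia).
  apply: runs_le (runs_if (n := (12 * sz Nil + 4) + 2 * 3) _) => //.
  by rewrite eqxx; apply: runs_seq (runs_drop _ _) (runs_push_data _ _).
rewrite addn2; apply: runs_if => /=; rewrite -catA.
apply: runs_seq; first exact: runs_pop.
by apply: runs_le (runs_eq _ _ _); lia.
Qed.

Lemma FP_if (p : data -> bool) f g :
  FP (fun x => db (p x)) -> FP f -> FP g -> FP (fun x => if p x then f x else g x).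
Proof.
move=> [B [e hp]] [P [c hf]] [Q [d hg]].
(* The constant 40 is [12 * 3 + 4], the time to drop the truth value, whose code has at most 3
   cells. *)
apply: (@FP_intro _ (Seq dup_top (Seq B
   (If RM (is_bc true) (Seq drop_top P) (Seq drop_top Q))))
  (fun n => 26 * n + 6 + (poly_bound e n + (40 + poly_bound c n + poly_bound d n).+2))).
  apply: (@pb_le _ (fun n => 26 * n + 6 + (poly_bound e n + (42 + poly_bound c n + poly_bound d n)))).
    by move=> n; lia.
  by pb.
move=> x; have [sg rg] := hg x; have [sf rf] := hf x; have [_ rp] := hp x.
split=> [|r]; first by case: ifP => _; lia.
apply: runs_seq (runs_dup x r) _.
apply: runs_seq (rp _) _.
apply: runs_if; have hd b : sz (db b) <= 3 by case: b.
case: (p x) => /=.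
  apply: (@runs_le _ _ _ (12 * sz (db true) + 4 + poly_bound c (sz x))).
    by rewrite /= /sz /=; lia.
  exact: runs_seq (runs_drop (db true) _) (rf r).
apply: (@runs_le _ _ _ (12 * sz (db false) + 4 + poly_bound d (sz x))).
  by rewrite /= /sz /=; lia.
exact: runs_seq (runs_drop (db false) _) (rg r).
Qed.

(** The remaining list lies above the accumulator. Removing the symbol of its [Cons] exposes the
    head and the tail; the rotation places the head directly above the accumulator, and one pushed
    symbol makes them the pair on which [P] acts. *)
Definition fold_loop (P : cmd) : cmd :=
  While RM (is_bc true) (Seq (Pop RM) (Seq rot_top
    (Seq (PushC RM (bc true)) (Seq P swap_top)))).

Lemma runs_fold_loop P g c B l acc r :
  computes P (fun z => g (tl z) (hd z)) c ->
  (forall s1 s2, l = s1 ++ s2 -> sz (foldl g acc s1) + sz (dl l) <= B) ->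
  runs (fold_loop P) (ms (enc (dl l) ++ enc acc ++ r))
    (ms (enc Nil ++ enc (foldl g acc l) ++ r))
    (size l * (28 * B + 25 + poly_bound c B) + 1).
Proof.
move=> hP; elim: l acc => [|a l IH] acc hB; first exact: runs_whileF.
have [sg rg] := hP (Cons a acc); rewrite /= in sg rg.
have h0 := hB [::] (a :: l) erefl.
have h1 := hB [:: a] l erefl.
rewrite /= !sz_Cons in h0 h1; rewrite sz_Cons in rg.
have hc : poly_bound c (sz a + sz acc).+1 <= poly_bound c B.
  by apply: leq_poly_bound => //; lia.
rewrite [size _]/= mulSn -addnA.
apply: (@runs_le _ _ _ ((28 * B + 23 + poly_bound c B).+2 +
    (size l * (28 * B + 25 + poly_bound c B) + 1))); first by lia.
apply: (runs_whileT (s2 := ms (enc (dl l) ++ enc (g acc a) ++ r))) => //; last first.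
  apply: IH => s1 s2 hs; have := hB (a :: s1) s2.
  by rewrite /= hs sz_Cons => /(_ erefl); lia.
apply: (@runs_le _ _ _ (1 + ((14 * (sz a + sz (dl l) + sz acc) + 12) +
   (2 + (poly_bound c (sz a + sz acc).+1 + (14 * (sz (g acc a) + sz (dl l)) + 8)))))).
  by move: hc h0 h1; lia.
apply: runs_seq; first exact: runs_pop.
rewrite /= -catA.
apply: runs_seq; first exact: runs_rot.
apply: runs_seq; first exact: runs_push.
rewrite /= catA.
apply: runs_seq; first by have := rg (enc (dl l) ++ r); rewrite /= -!catA; apply.
exact: runs_swap.
Qed.

Ltac fp := repeat first
  [ assumption | exact: FP_id | exact: FP_const | exact: (FP_hd FP_id) | exact: (FP_tl FP_id)
  | match goal with
    | |- FP (fun x => Cons (@?f x) (@?g x)) => apply: (@FP_Cons f g)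
    | |- FP (fun x => hd (@?f x)) => apply: (@FP_hd f)
    | |- FP (fun x => tl (@?f x)) => apply: (@FP_tl f)
    end ].

(** Iterating a polynomial-time step can produce exponential growth, hence the hypothesis that all
    intermediate values are polynomially bounded. The loop hands only an element and the accumulator
    to its body, so the parameter [x] is stored inside the accumulator. *)
Lemma FP_fold (l a0 : data -> data) (g : data -> data -> data -> data) b :
  FP l -> FP a0 -> FP (fun z => g (hd z) (hd (tl z)) (tl (tl z))) -> pbound b ->
  (forall x s1 s2, undl (l x) = s1 ++ s2 ->
     sz (foldl (fun acc a => g x a acc) (a0 x) s1) <= b (sz x)) ->
  FP (fun x => foldl (fun acc a => g x a acc) (a0 x) (undl (l x))).
Proof.
move=> hl ha hg [cb hb] hsz.
pose h z a := Cons (hd z) (g (hd z) a (tl z)).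
have [P [c hP]] : FP (fun z => h (tl z) (hd z)).
  rewrite /h; apply: FP_Cons; first by fp.
  apply: (@FP_comp _ (fun z => Cons (hd (tl z)) (Cons (hd z) (tl (tl z)))) hg).
  by fp.
have [Q [d hQ]] : FP (fun x => Cons (l x) (Cons x (a0 x))) by fp.
have hfold x acc s : foldl h (Cons x acc) s =
    Cons x (foldl (fun acc a => g x a acc) acc s).
  by elim: s acc => //= a s IH acc; rewrite IH.
suff: FP (fun x => Cons x (foldl (fun acc a => g x a acc) (a0 x) (undl (l x)))).
  by move=> /FP_tl.
(* Bounds the pair of [x] and an intermediate value, together with the list. *)
pose B n := (n + poly_bound cb n).+1 + poly_bound d n.
apply: (@FP_intro _ (Seq Q (Seq (Pop RM) (Seq (fold_loop P) (Pop RM))))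
  (fun n => poly_bound d n + (1 + ((poly_bound d n * (28 * B n + 25 + poly_bound c (B n)) + 1) + 1))
     + B n)).
  have pB : pbound B.
    apply: (@pb_le _ (fun n => (1 + (n + poly_bound cb n) + poly_bound d n))).
      by move=> n; rewrite /B; lia.
    by pb.
  by pb.
move=> x; have [sQ rQ] := hQ x; rewrite !sz_Cons in sQ.
have hx : sz (foldl (fun acc a => g x a acc) (a0 x) (undl (l x))) <= poly_bound cb (sz x).
  by apply: leq_trans (hb _); apply: (hsz _ _ [::]); rewrite cats0.
split=> [|r].
  by rewrite sz_Cons /B; lia.
apply: runs_le (leq_addr _ _) _.
apply: runs_seq (rQ r) _.
apply: runs_seq; first exact: runs_pop.
rewrite /= -{1}[l x]undlK -catA.
apply: (runs_seq (s2 := ms (enc Nil ++ enc (foldl h (Cons x (a0 x)) (undl (l x))) ++ r))).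
  have hB s1 s2 : undl (l x) = s1 ++ s2 ->
      sz (foldl h (Cons x (a0 x)) s1) + sz (dl (undl (l x))) <= B (sz x).
    move=> hs; rewrite hfold undlK sz_Cons.
    have := leq_trans (hsz _ _ _ hs) (hb _); rewrite /B; lia.
  apply: runs_le (runs_fold_loop r hP hB).
  rewrite leq_add2r leq_mul2r; apply/orP; right.
  by apply: leq_trans (size_le_sz _) _; lia.
by rewrite hfold; apply: runs_pop.
Qed.

(** The growth in one step does not depend on the accumulator, so the increments add up to at most
    the length of the list times a common bound. *)
Lemma FP_fold_lin (l a0 : data -> data) (g : data -> data -> data -> data) b :
  FP l -> FP a0 -> FP (fun z => g (hd z) (hd (tl z)) (tl (tl z))) -> pbound b ->
  (forall x a acc, sz (g x a acc) <= sz acc + b (sz x + sz a)) ->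
  FP (fun x => foldl (fun acc a => g x a acc) (a0 x) (undl (l x))).
Proof.
move=> hl ha hg [cb hb] hsz; have [cl hcl] := FP_size hl; have [ca hca] := FP_size ha.
apply: (@FP_fold l a0 g (fun n => poly_bound ca n +
   poly_bound cl n * poly_bound cb (n + poly_bound cl n))) => //.
  by pb.
move=> x s1 s2 hs.
suff h acc s : {subset s <= undl (l x)} ->
    sz (foldl (fun acc a => g x a acc) acc s) <=
    sz acc + size s * poly_bound cb (sz x + poly_bound cl (sz x)).
  apply: leq_trans (h _ _ _) _; first by move=> a; rewrite hs mem_cat => ->.
  apply: leq_add; first exact: hca.
  rewrite leq_mul2r; apply/orP; right.
  apply: leq_trans (hcl x); apply: leq_trans (size_le_sz _).
  by rewrite hs size_cat leq_addr.
elim: s acc => [|a s IH] acc hsub /=; first by rewrite addn0.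
apply: leq_trans (IH _ _) _; first by move=> y hy; apply: hsub; rewrite inE hy orbT.
rewrite mulSn addnA leq_add2r.
apply: leq_trans (hsz _ _ _) _; rewrite leq_add2l.
apply: leq_trans (hb _) _; apply: leq_poly_bound => //.
rewrite leq_add2l; apply: leq_trans (hcl x).
by apply: sz_mem; apply: hsub; rewrite mem_head.
Qed.

Lemma FP_not (p : data -> bool) :
  FP (fun x => db (p x)) -> FP (fun x => db (~~ p x)).
Proof.
move=> hp; apply: eq_FP (FP_if hp (FP_const (db false)) (FP_const (db true))) => x.
by case: (p x).
Qed.

Lemma FP_and (p q : data -> bool) : FP (fun x => db (p x)) ->
  FP (fun x => db (q x)) -> FP (fun x => db (p x && q x)).
Proof.
move=> hp hq; apply: eq_FP (FP_if hp hq (FP_const (db false))) => x.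
by case: (p x).
Qed.

Lemma FP_or (p q : data -> bool) : FP (fun x => db (p x)) ->
  FP (fun x => db (q x)) -> FP (fun x => db (p x || q x)).
Proof.
move=> hp hq; apply: eq_FP (FP_if hp (FP_const (db true)) hq) => x.
by case: (p x).
Qed.

Lemma FP_imp (p q : data -> bool) : FP (fun x => db (p x)) ->
  FP (fun x => db (q x)) -> FP (fun x => db (p x ==> q x)).
Proof.
move=> hp hq; apply: eq_FP (FP_if hp hq (FP_const (db true))) => x.
by case: (p x).
Qed.

Lemma FP_rev l : FP l -> FP (fun x => dl (rev (undl (l x)))).
Proof.
move=> hl.
have := @FP_fold_lin l (fun=> Nil) (fun _ a acc => Cons a acc) S hl.
case=> //.
- exact: FP_const.
- by fp.
- by apply: (@pb_le _ (fun n => 1 + n)) => //; pb.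
- by move=> x a acc; rewrite sz_Cons; lia.
move=> P [c h]; exists P, c; move: h; congr (computes _ _ _).
apply: funext => x; rewrite /rev -[Nil]/(dl [::]).
by elim: (undl (l x)) [::] => //= a s IH t; rewrite -IH.
Qed.

Lemma FP_map (h : data -> data -> data) l :
  FP (fun z => h (hd z) (tl z)) -> FP l ->
  FP (fun x => dl [seq h x a | a <- undl (l x)]).
Proof.
move=> hh hl; have [c hc] := FP_size hh.
have H : FP (fun x => foldl (fun acc a => Cons (h x a) acc) Nil (undl (l x))).
  apply: (@FP_fold_lin l (fun=> Nil) (fun x a acc => Cons (h x a) acc)
    (fun n => 1 + poly_bound c (1 + n))) => //.
  - exact: FP_const.
  - apply: FP_Cons; last by fp.
    by apply: (@FP_comp _ (fun z => Cons (hd z) (hd (tl z))) hh); fp.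
  - by pb.
  move=> x a acc; rewrite sz_Cons; have := hc (Cons x a); rewrite sz_Cons /=.
  by rewrite !add1n; lia.
apply: eq_FP (FP_rev H) => x; congr dl.
have -> s t : foldl (fun acc a => Cons (h x a) acc) t s = dl (catrev (map (h x) s) (undl t)).
  by elim: s t => [|a s IH] t /=; [rewrite undlK | rewrite IH].
by rewrite dlK revK.
Qed.

Lemma FP_cat f g : FP f -> FP g -> FP (fun x => dl (undl (f x) ++ undl (g x))).
Proof.
move=> hf hg.
have H : FP (fun x => foldl (fun acc a => Cons a acc) (g x) (undl (dl (rev (undl (f x)))))).
  apply: (@FP_fold_lin (fun x => dl (rev (undl (f x)))) g (fun x a acc => Cons a acc) S) => //.
  - exact: FP_rev.
  - by fp.
  - by apply: (@pb_le _ (fun n => 1 + n)) => //; pb.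
  by move=> x a acc; rewrite sz_Cons; lia.
apply: eq_FP H => x; rewrite dlK.
have -> s t : foldl (fun acc a => Cons a acc) t s = dl (catrev s (undl t)).
  by elim: s t => [|a s IH] t /=; [rewrite undlK | rewrite IH].
by rewrite catrevE revK.
Qed.

Lemma FP_flatmap (h : data -> data -> data) l :
  FP (fun z => h (hd z) (tl z)) -> FP l ->
  FP (fun x => dl (flatten [seq undl (h x a) | a <- undl (l x)])).
Proof.
move=> hh hl; have [c hc] := FP_size hh.
have H : FP (fun x => foldl (fun acc a => dl (undl acc ++ undl (h x a))) Nil (undl (l x))).
  apply: (@FP_fold_lin l (fun=> Nil) (fun x a acc => dl (undl acc ++ undl (h x a)))
    (fun n => poly_bound c (1 + n))) => //.
  - exact: FP_const.
  - apply: FP_cat; first by fp.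
    by apply: (@FP_comp _ (fun z => Cons (hd z) (hd (tl z))) hh); fp.
  - by pb.
  move=> x a acc; have := hc (Cons x a); rewrite sz_Cons /= add1n.
  rewrite -[sz acc](congr1 sz (undlK acc)) -[sz (h x a)](congr1 sz (undlK (h x a))).
  by rewrite !sz_dl map_cat sumn_cat; lia.
apply: eq_FP H => x.
have -> s t : foldl (fun acc a => dl (undl acc ++ undl (h x a))) t s =
    dl (undl t ++ flatten [seq undl (h x a) | a <- s]).
  by elim: s t => [|a s IH] t /=; [rewrite cats0 undlK | rewrite IH dlK catA].
by [].
Qed.

Lemma FP_all (p : data -> data -> bool) l :
  FP (fun z => db (p (hd z) (tl z))) -> FP l ->
  FP (fun x => db (all (p x) (undl (l x)))).
Proof.
move=> hp hl.
have H : FP (fun x => foldl (fun acc a => if p x a then acc else Nil) (db true) (undl (l x))).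
  apply: (@FP_fold_lin l (fun=> db true) (fun x a acc => if p x a then acc else Nil)
    (fun=> 1)) => //.
  - exact: FP_const.
  - apply: FP_if; [|by fp..].
    by apply: (@FP_comp _ (fun z => Cons (hd z) (hd (tl z))) hp); fp.
  - by pb.
  by move=> x a acc; case: ifP => _; rewrite ?leq_addr // leq_addl.
apply: eq_FP H => x.
have -> s b : foldl (fun acc a => if p x a then acc else Nil) (db b) s =
    db (b && all (p x) s).
  elim: s b => [|a s IH] b /=; first by rewrite andbT.
  by case: ifP => _; [rewrite IH | rewrite -[Nil]/(db false) IH /= andbF].
by [].
Qed.

Lemma FP_mem f l : FP f -> FP l -> FP (fun x => db (f x \in undl (l x))).
Proof.
move=> hf hl.
have H : FP (fun x => db (~~ all (fun a => ~~ (a == f x)) (undl (l x)))).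
  apply: FP_not; apply: (@FP_all (fun x a => ~~ (a == f x))) => //.
  apply: FP_not; apply: FP_eq; first by fp.
  by apply: (@FP_comp f (fun z => hd z)) => //; fp.
apply: eq_FP H => x; congr db.
by rewrite -has_predC -has_pred1; apply: eq_has => y /=; rewrite negbK.
Qed.

(** * Loading the input and the certificate *)

Definition dtok (t : token) : data :=
  dl (nseq (match t with TVar => 0 | TOpen => 1 | TClose => 2 | TSep => 3
                       | Bit b => 4 + b end) Nil).

Lemma dtok_inj : injective dtok.
Proof. by case=> [[]||||] [[]||||] //; vm_compute; discriminate. Qed.

Definition load_token : cmd :=
  foldr (fun t c => If RI (fun o => o == Some (inl t)) (push_data (enc (dtok t))) c)
    Skip [:: Bit true; Bit false; TVar; TOpen; TClose; TSep].

Lemma runs_load_token t i c m :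
  runs load_token (Store (inl t :: i) c m [::] [::] [::] [::])
    (Store (inl t :: i) c (enc (dtok t) ++ m) [::] [::] [::] [::]) 40.
Proof.
pose s := Store (inl t :: i) c m [::] [::] [::] [::].
have h v n : 2 * size v <= n -> runs (push_data v) s (set_reg s RM (v ++ m)) n.
  by move=> hn; apply: runs_le hn (runs_push_store v s).
have hT c1 c2 (b : option cell -> bool) n s' :
    b (Some (inl t)) -> runs c1 s s' n -> runs (If RI b c1 c2) s s' n.+2.
  by move=> hb hc; apply: runs_if; rewrite /= hb.
have hF c1 c2 (b : option cell -> bool) n s' :
    ~~ b (Some (inl t)) -> runs c2 s s' n -> runs (If RI b c1 c2) s s' n.+2.
  by move=> hb hc; apply: runs_if; rewrite /= (negbTE hb).
rewrite /load_token; cbn [foldr].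
by case: t @s h hT hF => [[]||||] s h hT hF;
  repeat first [apply: (hT); [by []|] | apply: (hF); [by []|]]; apply: h.
Qed.

Definition load_tokens : cmd :=
  While RI nonempty (Seq load_token (Seq (PushC RM (bc true)) (Pop RI))).

Lemma runs_load_tokens x c d r :
  runs load_tokens
    (Store [seq inl a | a <- x] c (enc d ++ r) [::] [::] [::] [::])
    (Store [::] c (enc (foldl (fun acc t => Cons (dtok t) acc) d x) ++ r)
       [::] [::] [::] [::]) (45 * size x + 1).
Proof.
elim: x d => [|t x IH] d; first exact: runs_whileF.
apply: (@runs_le _ _ _ (43.+2 + (45 * size x + 1))); first by rewrite /=; lia.
apply: runs_whileT (IH (Cons (dtok t) d)) => //.
apply: (@runs_le _ _ _ (40 + (2 + 1))) => //.
apply: runs_seq; first exact: runs_load_token.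
apply: runs_seq; first exact: runs_push.
by apply: runs_pop; rewrite /= -!catA.
Qed.

Definition load_bits : cmd :=
  While RC nonempty
    (Seq (If RC (is_bc true) (push_data (enc (db true))) (push_data (enc (db false))))
      (Seq (PushC RM (bc true)) (Pop RC))).

Lemma runs_load_bits u d r :
  runs load_bits
    (Store [::] [seq inr (inl b) | b <- u] (enc d ++ r) [::] [::] [::] [::])
    (ms (enc (foldl (fun acc b => Cons (db b) acc) d u) ++ r)) (13 * size u + 1).
Proof.
elim: u d => [|b u IH] d; first exact: runs_whileF.
apply: (@runs_le _ _ _ (11.+2 + (13 * size u + 1))); first by rewrite /=; lia.
apply: runs_whileT (IH (Cons (db b) d)) => //.
apply: (@runs_le _ _ _ (8 + (2 + 1))) => //.
apply: (runs_seq (s2 := Store [::] [seq inr (inl b) | b <- b :: u]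
   (enc (db b) ++ enc d ++ r) [::] [::] [::] [::])).
  apply: runs_if.
  have -> : (if is_bc true (Some (inr (inl b))) then push_data (enc (db true))
             else push_data (enc (db false))) = push_data (enc (db b)) by case: b.
  by apply: runs_le (runs_push_store _ _); case: b.
apply: runs_seq; first exact: runs_push.
by apply: runs_pop; rewrite /= -!catA.
Qed.

(** The loaders extend a list by [Cons], so each is preceded by a push of [Nil], a single cell; the
    last push joins the two lists into a pair. *)
Definition main_cmd (P : cmd) : cmd :=
  Seq (PushC RM (bc false)) (Seq load_tokens (Seq (PushC RM (bc false))
    (Seq load_bits (Seq (PushC RM (bc true)) P)))).

(* The loaders reverse the two words. *)
Definition input_data (x : seq token) (u : seq bool) : data :=
  Cons (dl (rev (map db u))) (dl (rev (map dtok x))).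

(** A token takes at most 11 cells, a bit at most 3, and each list node one more; the final 3 cells
    are the pair and the two ends of lists. *)
Lemma sz_input_data x u : sz (input_data x u) <= 12 * (size x + size u) + 3.
Proof.
rewrite /input_data sz_Cons !sz_dl !map_rev !sumn_rev -!map_comp.
have h1 : sumn [seq (sz (db b)).+1 | b <- u] <= 4 * size u.
  by elim: u => //= b u IH; rewrite mulnS leq_add //; case: b.
have h2 : sumn [seq (sz (dtok b)).+1 | b <- x] <= 12 * size x.
  by elim: x => //= b x IH; rewrite mulnS leq_add //; case: b => [[]||||].
by move: h1 h2; rewrite /comp; lia.
Qed.

Lemma machine_of_FP (p : data -> bool) : FP (fun z => db (p z)) ->
  exists (M : machine token) c, forall x u,
    result M x u (poly_bound c (size x + size u)) = Some (p (input_data x u)).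
Proof.
case=> P [c hP].
have [k hk] : pbound (fun n => 2 + ((45 * n + 1) + (2 + ((13 * n + 1) +
    (2 + poly_bound c (12 * n + 3))))) + 1) by pb.
exists (mach (compile (main_cmd P) 0) (is_bc true)), k => x u.
have [_ /(_ [::]) rP] := hP (input_data x u).
have [n hn e] : runs (main_cmd P) (input_store x u) (ms (enc (db (p (input_data x u)))))
    (2 + ((45 * size x + 1) + (2 + ((13 * size u + 1) +
      (2 + poly_bound c (sz (input_data x u))))))).
  apply: runs_seq; first exact: runs_push.
  apply: runs_seq; first exact: (@runs_load_tokens x _ Nil [::]).
  apply: runs_seq; first exact: runs_push.
  apply: runs_seq; first exact: (@runs_load_bits u Nil).
  apply: runs_seq; first exact: runs_push.
  move: rP; rewrite /= !cats0; congr (runs _ _ _ _); congr ms; congr (_ :: _).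
  congr (enc _ ++ enc _); rewrite /rev -[Nil]/(dl [::]).
    by elim: u [::] => //= b u IH s; rewrite -IH.
  by elim: x [::] => //= b x IH s; rewrite -IH.
rewrite (result_mono _ (exec_result (is_bc true) e)) /=; first by case: (p _).
apply: leq_trans (hk _).
have := leq_poly_bound (leqnn c) (sz_input_data x u).
move: hn; move: (poly_bound c (12 * _ + 3)) (poly_bound c (sz _)) => A B.
by move: (size x) (size u); clear; lia.
Qed.

(** * Saturated pairs *)

HB.instance Definition _ (S : signature) := gen_eqMixin (form S).
HB.instance Definition _ (S : signature) := gen_eqMixin (schema S).

Section Formulas.
Variable S : signature.
Implicit Types (f g h : form S) (e : nat -> form S).

Fixpoint subst e f : form S :=
  match f with
  | Var p => e p
  | App c a => App c (fun i => subst e (a i))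
  end.

Lemma subst_endo e : endomorphism (subst e). Proof. by []. Qed.

(** Formulas are freely generated by the variables, so an endomorphism is determined by its values
    on them. *)
Lemma endo_subst (s : form S -> form S) f :
  endomorphism s -> s f = subst (fun p => s (Var p)) f.
Proof.
move=> hs; elim: f => //= c a IH; rewrite hs; congr App.
by apply: funext => i; exact: IH.
Qed.

Lemma sub_refl f : sub f f.
Proof. by case: f => [p|c a] //=; left. Qed.

Lemma sub_trans f g h : sub f g -> sub g h -> sub f h.
Proof.
elim: f => [p|c a IH] /=; first by move=> ->.
case=> [-> //|[i _ hi] hgh]; right; exists i => //.
exact: IH hi hgh.
Qed.

Lemma sub_substE e f g :
  sub (subst e f) g -> (exists2 h, sub f h & g = subst e h) \/ exists p, sub (e p) g.
Proof.
elim: f => [p|c a IH] /=; first by right; exists p.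
case=> [->|[i _ /IH[[h hh ->]|]]]; last by right.
  by left; exists (App c a) => //; left.
by left; exists h => //; right; exists i.
Qed.

Lemma sub_subst e f g : sub f g -> sub (subst e f) (subst e g).
Proof.
elim: f => [p /= ->|c a IH] /=; first exact: sub_refl.
case=> [->|[i _ /IH hi]]; first by left.
by right; exists i.
Qed.

Lemma eq_subst e e' f :
  (forall p, sub f (Var p) -> e p = e' p) -> subst e f = subst e' f.
Proof.
elim: f => [p|c a IH] /= h; first exact: h.
congr App; apply: funext => i; apply: IH => p hp; apply: h.
by right; exists i.
Qed.

Fixpoint subl f : seq (form S) :=
  f :: match f with
       | Var _ => [::]
       | App c a => flatten [seq subl (a i) | i <- enum 'I_(ar c)]
       end.

Lemma sublP f g : sub f g <-> g \in subl f.
Proof.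
elim: f => [p|c a IH].
  by rewrite /= inE; split=> [->|/eqP].
rewrite [subl _]/= inE.
split=> [[->|[i _ /IH hi]]|/orP[/eqP ->|/flatten_mapP[i _ /IH hi]]].
- by rewrite eqxx.
- by apply/orP; right; apply/flatten_mapP; exists i => //; rewrite mem_enum.
- by left.
by right; exists i.
Qed.

Lemma var_bound (F : seq (form S)) :
  exists K, forall f p, f \in F -> sub f (Var p) -> p < K.
Proof.
exists (\max_(g <- flatten (map subl F)) (if g is Var p then p else 0)).+1.
move=> f p hf /sublP hp; rewrite ltnS.
apply: (@leq_bigmax_seq _ _ xpredT (fun g => if g is Var p then p else 0) (Var p)) => //.
by apply/flatten_mapP; exists f.
Qed.

Lemma finite_list (A : set (form S)) :
  finite_set A -> exists s : seq (form S), forall f, A f <-> f \in s.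
Proof. by move=> /finite_seqP[s ->]; exists s. Qed.

Definition sub_closed (T : seq (form S)) : Prop :=
  forall f g, f \in T -> sub f g -> g \in T.

(* [Var 0] is there to instantiate the variables that a rule does not mention,
   even when [F] is empty. *)
Definition closure (F : seq (form S)) : seq (form S) :=
  Var 0 :: flatten (map subl F).

Lemma mem_closure F f g : f \in F -> sub f g -> g \in closure F.
Proof.
move=> hf /sublP hg; rewrite inE; apply/orP; right.
by apply/flatten_mapP; exists f.
Qed.

Lemma closure_Var0 F : Var 0 \in closure F.
Proof. exact: mem_head. Qed.

Lemma closure_sub_closed F : sub_closed (closure F).
Proof.
move=> f g; rewrite inE => /orP[/eqP->|/flatten_mapP[h hh /sublP hf] hg].
  by move=> /= ->; apply: closure_Var0.
by apply: (mem_closure hh); apply: sub_trans hg.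
Qed.

End Formulas.

Fixpoint tuples (A : Type) (k : nat) (s : seq A) : seq (seq A) :=
  if k is k'.+1 then flatten [seq [seq a :: e | e <- tuples k' s] | a <- s]
  else [:: [::]].

Lemma map_tuples (A B : Type) (f : A -> B) k s :
  tuples k (map f s) = map (map f) (tuples k s).
Proof.
elim: k => //= k ->; rewrite map_flatten -!map_comp; congr flatten.
by apply: eq_map => a /=; rewrite -!map_comp.
Qed.

Lemma mem_tuples (A : eqType) k (s e : seq A) :
  e \in tuples k s <-> size e = k /\ {subset e <= s}.
Proof.
elim: k e => [|k IH] e /=.
  rewrite inE; split=> [/eqP->|[/size0nil -> _]] //.
split.
  case/flatten_mapP=> a ha /mapP[e' /IH[hs he] ->].
  split=> [|b]; first by rewrite /= hs.
  by rewrite inE => /orP[/eqP->|/he].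
case: e => [[]//|a e [[hk] he]]; apply/flatten_mapP; exists a.
  by apply: he; rewrite mem_head.
apply/mapP; exists e => //; apply/IH; split=> // b hb.
by apply: he; rewrite inE hb orbT.
Qed.

Section Saturation.
Variables (S : signature) (C : set (schema S)) (Phi : bstatement S).

(* [G true] and [G false] are the accepted and the rejected formulas. *)
Definition saturated (X : set (form S)) (G : bool -> set (form S)) : Prop :=
  forall r, instances C r ->
    (forall f, antA r f -> X f /\ G true f) ->
    (forall f, antR r f -> X f /\ G false f) ->
    (forall f, sucA r f \/ sucR r f -> X f) ->
    exists f, sucA r f /\ G true f \/ sucR r f /\ G false f.

Definition separates (G : bool -> set (form S)) : Prop :=
  [/\ forall f, accepted Phi f -> G true f,
      forall f, rejected Phi f -> G false f,
      forall f, nonaccepted Phi f -> ~ G true f &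
      forall f, nonrejected Phi f -> ~ G false f].

Lemma all_labels_root Q l (d : derivation C l) : all_labels Q d -> Q l.
Proof. by case: d => [l'|GA GR r ? ? ? ? d|GA GR r ? ? ? ? dA dR] /= []. Qed.

(* The branch of an analytic derivation that stays inside a saturated pair
   never reaches a closed leaf. *)
Lemma saturated_unprovable Lambda X G :
  analytic Lambda C -> (forall f, gensub Lambda Phi f -> X f) ->
  separates G -> saturated X G -> ~ provable C Phi.
Proof.
move=> han hX [hA hR hnA hnR] hsat /han[GA [GR [d [[sA sR hleaf] hlab]]]].
suff H l (d' : derivation C l) : all_leaves (closed_label Phi) d' ->
    all_labels (label_in (gensub Lambda Phi)) d' ->
    (if l is Some (GA, GR) then
       (forall f, GA f -> G true f) /\ (forall f, GR f -> G false f) else False) ->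
    False.
  by apply: H hleaf hlab _; split=> f hf; [apply: hA; apply: sA | apply: hR; apply: sR].
elim: d' => {GA GR d sA sR hleaf hlab l}.
- case=> [[GA GR]|] //= hc _ [iA iR].
  by case: hc => -[f [h1 h2]]; [apply: (hnA f h2); apply: iA | apply: (hnR f h2); apply: iR].
- move=> GA GR r hr aA aR [sA sR] d _ /= _ [[lA lR] _] [iA iR].
  have [||f|f] := hsat r hr.
  + by move=> f /aA hf; split; [apply: hX; apply: lA | apply: iA].
  + by move=> f /aR hf; split; [apply: hX; apply: lR | apply: iR].
  + by rewrite sA sR => -[].
  by rewrite sA sR => -[[]|[]].
move=> GA GR r hr aA aR _ dA IHA dR IHR /= [leA leR] [[lA lR] [laA laR]] [iA iR].
have [||f|f] := hsat r hr.
- by move=> f /aA hf; split; [apply: hX; apply: lA | apply: iA].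
- by move=> f /aR hf; split; [apply: hX; apply: lR | apply: iR].
- case=> hf; apply: hX.
    by have [h _] := all_labels_root (laA f hf); apply: h; right.
  by have [_ h] := all_labels_root (laR f hf); apply: h; right.
case=> -[hf hG].
  by apply: (IHA f hf) => //; split=> // g [/iA|->].
by apply: (IHR f hf) => //; split=> // g [/iR|->].
Qed.

Definition derivable (GA GR : set (form S)) : Prop :=
  exists d : derivation C (Some (GA, GR)), all_leaves (closed_label Phi) d.

(** [Expand] takes functions that return derivations, whereas [derivable] only asserts existence;
    [cid] makes the choice. An empty succedent requires [Close] instead. *)
Lemma derivable_instance GA GR r : instances C r ->
  (forall f, antA r f -> GA f) -> (forall f, antR r f -> GR f) ->
  (forall f, sucA r f -> derivable (GA `|` [set f]) GR) ->
  (forall f, sucR r f -> derivable GA (GR `|` [set f])) ->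
  derivable GA GR.
Proof.
move=> hr aA aR hA hR.
have [h0|h0] := pselect (sucA r = set0 /\ sucR r = set0).
  by exists (Close hr aA aR h0 (Leaf C None)).
pose dA f h := projT1 (cid (hA f h)); pose dR f h := projT1 (cid (hR f h)).
exists (Expand hr aA aR h0 dA dR); split=> f h.
  exact: (projT2 (cid (hA f h))).
exact: (projT2 (cid (hR f h))).
Qed.

(** As long as an underivable pair is not saturated, some instance has its antecedent in the pair,
    and its succedent in [X] but disjoint from the pair. If adding any one succedent formula gave a
    derivable pair, the instance would derive the pair itself; so some addition stays underivable.
    The number [m GA + m GR] of formulas of [X] missing from the pair decreases, and the process
    ends. *)
Lemma unprovable_saturated (X : seq (form S)) :
  (forall f, accepted Phi f \/ rejected Phi f -> f \in X) -> ~ provable C Phi ->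
  exists G, [/\ forall b f, G b f -> f \in X, separates G &
                saturated [set f | f \in X] G].
Proof.
move=> hX hprov.
pose m (G : set (form S)) := count (fun f => `[< ~ G f >]) X.
have hm (G : set (form S)) f : f \in X -> ~ G f -> m (G `|` [set f]) < m G.
  rewrite /m; elim: X {hX m} => //= g X IH hfX hf.
  have hle h : (`[< ~ (G `|` [set f]) h >] <= `[< ~ G h >])%N.
    case: (asboolP (~ (G `|` [set f]) h)) => // h1.
    by case: (asboolP (~ G h)) => // h2; exfalso; apply: h2 => hh; apply: h1; left.
  move: hfX; rewrite inE => /orP[/eqP <-|/IH /(_ hf) h]; last first.
    by rewrite -addnS leq_add // hle.
  rewrite (asboolT hf) asboolF; last by apply; right.
  rewrite add0n add1n ltnS; apply: sub_count => h.
  by have := hle h; case: `[< _ >] => //; case: `[< _ >].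
suff H n GA GR : m GA + m GR < n -> (forall f, accepted Phi f -> GA f) ->
    (forall f, rejected Phi f -> GR f) -> (forall f, GA f -> f \in X) ->
    (forall f, GR f -> f \in X) -> ~ derivable GA GR ->
    exists G, [/\ forall b f, G b f -> f \in X, separates G &
                saturated [set f | f \in X] G].
  apply: (H _ (accepted Phi) (rejected Phi) (ltnSn _)) => // [f hf|f hf|[d hd]].
  - by apply: hX; left.
  - by apply: hX; right.
  by apply: hprov; exists (accepted Phi), (rejected Phi), d; split.
elim: n GA GR => // n IH GA GR hn hA hR inA inR hder.
pose G b := if b then GA else GR.
have [hsat|hsat] := pselect (saturated [set f | f \in X] G).
  exists G; split=> //; first by case=> f; [apply: inA | apply: inR].
  (* A pair that meets the nonaccepted or the nonrejected formulas is derivable by a single leaf. *)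
  by split=> // f hf hG; apply: hder; exists (Leaf C _); [left|right]; exists f.
have [r [hr aA aR hX' hno]] : exists r, [/\ instances C r,
    forall f, antA r f -> GA f, forall f, antR r f -> GR f,
    forall f, sucA r f \/ sucR r f -> f \in X &
    forall f, ~ (sucA r f /\ GA f \/ sucR r f /\ GR f)].
  apply: contrapT => hno; apply: hsat => r hr aA aR hs.
  apply: contrapT => hf; apply: hno; exists r; split=> //.
  - by move=> f /aA[].
  - by move=> f /aR[].
  by move=> f h; apply: hf; exists f.
apply: contrapT => hG; apply: hder; apply: derivable_instance hr aA aR _ _ => f hf.
  apply: contrapT => hd; apply: hG; apply: (IH (GA `|` [set f]) GR) => //.
  - rewrite -ltnS; apply: leq_trans hn; rewrite ltnS ltn_add2r hm //.
      by apply: hX'; left.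
    by move=> h; apply: (hno f); left.
  - by move=> g /hA hg; left.
  by move=> g [/inA //|->]; apply: hX'; left.
apply: contrapT => hd; apply: hG; apply: (IH GA (GR `|` [set f])) => //.
- rewrite -ltnS; apply: leq_trans hn; rewrite ltnS ltn_add2l hm //.
    by apply: hX'; right.
  by move=> h; apply: (hno f); right.
- by move=> g /hR hg; left.
by move=> g [/inR //|->]; apply: hX'; right.
Qed.
End Saturation.

(** * Reduction of rule instances to finitely many tuples *)

Section Instances.
Variable S : signature.

(* Antecedent and succedent; the sign [true] marks accepted formulas. *)
Definition rule : Type := (seq (bool * form S) * seq (bool * form S))%type.

Definition rule_spec (r : schema S) (ac : rule) : Prop :=
  forall f, [/\ antA r f <-> (true, f) \in ac.1, antR r f <-> (false, f) \in ac.1,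
                sucA r f <-> (true, f) \in ac.2 & sucR r f <-> (false, f) \in ac.2].

Lemma signed_list (A B : set (form S)) : finite_set A -> finite_set B ->
  exists s : seq (bool * form S), forall f,
    (A f <-> (true, f) \in s) /\ (B f <-> (false, f) \in s).
Proof.
move=> /finite_list[a ha] /finite_list[b hb].
exists (map (pair true) a ++ map (pair false) b) => f.
rewrite !mem_cat; split.
  apply: iff_trans (ha f) _; split=> [h|/orP[/mapP[g hg [->]] //|/mapP[g _ //]]].
  by apply/orP; left; apply: map_f.
apply: iff_trans (hb f) _; split=> [h|/orP[/mapP[g _ //]|/mapP[g hg [->]] //]].
by apply/orP; right; apply: map_f.
Qed.

Lemma rule_list (C : set (schema S)) :
  finite_set C -> (forall r, C r -> finitary r) ->
  exists R : seq rule,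
    (forall r, C r -> exists2 ac, ac \in R & rule_spec r ac) /\
    (forall ac, ac \in R -> exists2 r, C r & rule_spec r ac).
Proof.
move=> /finite_seqP[Cl ->] hfin.
have /choice[rl hrl] r : exists ac, r \in Cl -> rule_spec r ac.
  have [hr|hr] := boolP (r \in Cl); last by exists ([::], [::]).
  have [h1 h2 h3 h4] := hfin r hr.
  have [a ha] := signed_list h1 h3; have [c hc] := signed_list h2 h4.
  exists (a, c) => _ f; have [a1 a2] := ha f; have [c1 c2] := hc f.
  by split.
exists (map rl Cl); split=> [r hr|ac /mapP[r hr ->]].
  by exists (rl r); [apply: map_f | apply: hrl].
by exists r => //; apply: hrl.
Qed.

Notation env := (nth (Var 0)).

(** A tuple stands for the substitution that sends the variable [p] to its entry number [p], and to
    [Var 0] beyond its length. *)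
Definition insts (L T : seq (form S)) (K : nat) : seq (form S) :=
  flatten [seq [seq subst (env e) f | e <- tuples K T] | f <- L].

Lemma instsP L T K g :
  g \in insts L T K <->
  exists f e, [/\ f \in L, e \in tuples K T & g = subst (env e) f].
Proof.
split=> [/flatten_mapP[f hf /mapP[e he ->]]|[f [e [hf he ->]]]].
  by exists f, e.
by apply/flatten_mapP; exists f => //; apply/mapP; exists e.
Qed.

Lemma env_mem (T e : seq (form S)) K p :
  Var 0 \in T -> e \in tuples K T -> env e p \in T.
Proof.
move=> h0 /mem_tuples[_ he]; have [lt|ge] := ltnP p (size e).
  by apply: he; apply: mem_nth.
by rewrite nth_default.
Qed.

(** A substitution may take values outside [T] at variables that do not matter; these entries are
    replaced by [Var 0]. *)
Lemma env_tuple (T : seq (form S)) K (s : nat -> form S) : Var 0 \in T ->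
  exists2 e, e \in tuples K T & forall p, p < K -> s p \in T -> env e p = s p.
Proof.
move=> h0; exists (mkseq (fun p => if s p \in T then s p else Var 0) K).
  apply/mem_tuples; rewrite size_mkseq; split=> // f /mapP[p _ ->].
  by case: ifP.
by move=> p hp hs; rewrite nth_mkseq // hs.
Qed.

Section Bounded.
Variables (L : seq (form S)) (K : nat).
Hypotheses (L0 : Var 0 \in L) (Lsub : sub_closed L).
Hypothesis LK : forall f p, f \in L -> sub f (Var p) -> p < K.

(** The formula [Var 0] of [L] can be instantiated by any element of [T]. *)
Lemma insts_base T : Var 0 \in T -> {subset T <= insts L T K}.
Proof.
move=> h0 f hf; have [e he hp] := @env_tuple T K (fun=> f) h0.
apply/instsP; exists (Var 0), e; split=> //=.
by rewrite hp //; apply: (LK L0).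
Qed.

(** A subformula of an instance is either an instance of a subformula, which remains in [L], or a
    subformula of a substituted formula, which remains in [T] and is covered by [insts_base]. *)
Lemma insts_sub_closed T :
  Var 0 \in T -> sub_closed T -> sub_closed (insts L T K).
Proof.
move=> h0 hT f g /instsP[f' [e [hf' he ->]]] /sub_substE[[h hh ->]|[p hp]].
  by apply/instsP; exists h, e; split=> //; apply: Lsub hh.
by apply: insts_base => //; apply: hT hp; apply: env_mem he.
Qed.

Lemma insts_gensub Lambda Phi T : Var 0 \in T ->
  (forall f, Lambda f -> f \in L) -> (forall f, sub_stmt Phi f -> f \in T) ->
  forall f, gensub Lambda Phi f -> f \in insts L T K.
Proof.
move=> h0 hL hT f [/hT|[psi [s [hpsi hs hv ->]]]]; first exact: insts_base.
have [e he hp] := @env_tuple T K (fun p => s (Var p)) h0.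
apply/instsP; exists psi, e; split=> //; first exact: hL.
rewrite (endo_subst _ hs); apply: eq_subst => p hp'.
by rewrite hp //; [apply: LK hp'; apply: hL | apply: hT].
Qed.

End Bounded.

(** The finitely testable form of [saturated]: one test for each rule and each [K]-tuple over
    [X]. *)
Definition closed_under (R : seq rule) (X : seq (form S)) (K : nat)
    (G : bool -> set (form S)) : Prop :=
  forall ac e, ac \in R -> e \in tuples K X ->
    (forall bf, bf \in ac.1 -> G bf.1 (subst (env e) bf.2)) ->
    (forall bf, bf \in ac.2 -> subst (env e) bf.2 \in X) ->
    exists2 bf, bf \in ac.2 & G bf.1 (subst (env e) bf.2).

Section Rules.
Variables (C : set (schema S)) (R : seq rule) (X : seq (form S)) (K : nat).
Hypothesis CR : forall r, C r -> exists2 ac, ac \in R & rule_spec r ac.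
Hypothesis RC : forall ac, ac \in R -> exists2 r, C r & rule_spec r ac.
Hypothesis RK : forall ac bf p,
  ac \in R -> bf \in ac.1 ++ ac.2 -> sub bf.2 (Var p) -> p < K.

(** For a formula [f] of the rule with [s f] in [X], the values of [s] at the variables of [f] are
    subformulas of [s f], hence in [X]. So on the whole rule [s] agrees with a tuple over [X], and
    the test for this tuple applies. *)
Lemma closed_saturated G : Var 0 \in X -> sub_closed X ->
  closed_under R X K G -> saturated C [set f | f \in X] G.
Proof.
move=> h0 hX hG _ [r [s [hr hs ->]]] /= aA aR hsuc.
have [ac hac hspec] := CR hr.
have [e he hp] := @env_tuple X K (fun p => s (Var p)) h0.
have hse bf : bf \in ac.1 ++ ac.2 -> s bf.2 \in X -> subst (env e) bf.2 = s bf.2.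
  move=> hbf hin; rewrite [RHS](endo_subst _ hs); apply: eq_subst => p hsub.
  apply: hp; first exact: RK hbf hsub.
  by apply: hX hin _; rewrite (endo_subst bf.2 hs); apply: (@sub_subst _ _ _ (Var p)).
have h1 bf : bf \in ac.1 -> s bf.2 \in X /\ G bf.1 (s bf.2).
  case: bf => -[] f hf; have [i1 i2 _ _] := hspec f.
    by apply: aA; exists f => //; apply/i1.
  by apply: aR; exists f => //; apply/i2.
have h2 bf : bf \in ac.2 -> s bf.2 \in X.
  case: bf => -[] f hf; have [_ _ i1 i2] := hspec f; apply: hsuc.
    by left; exists f => //; apply/i1.
  by right; exists f => //; apply/i2.
have [||[b f] hf hGf] := hG ac e hac he.
- move=> bf hbf; have [hx hg] := h1 bf hbf.
  by rewrite hse // mem_cat hbf.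
- by move=> bf hbf; rewrite hse ?mem_cat ?hbf ?orbT //; apply: h2.
rewrite hse ?mem_cat ?hf ?orbT //= in hGf; last exact: h2 hf.
have [_ _ i1 i2] := hspec f.
exists (s f); case: b hf hGf => hf hGf; [left|right]; split=> //; exists f => //.
  by apply/i1.
by apply/i2.
Qed.

Lemma saturated_closed G : (forall b f, G b f -> f \in X) ->
  saturated C [set f | f \in X] G -> closed_under R X K G.
Proof.
move=> hGX hG ac e hac _ hant hsuc; have [r hr hspec] := RC hac.
have hi : instances C (subst_schema (subst (env e)) r).
  by exists r, (subst (env e)); split=> //; apply: subst_endo.
have hA f : antA r f -> G true (subst (env e) f).
  by have [h _ _ _] := hspec f => /h; apply: hant.
have hR f : antR r f -> G false (subst (env e) f).
  by have [_ h _ _] := hspec f => /h; apply: hant.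
have hS f : sucA r f \/ sucR r f -> subst (env e) f \in X.
  have [_ _ h1 h2] := hspec f.
  by case=> [/h1|/h2]; apply: hsuc.
case: (hG _ hi).
- by move=> _ [f /hA hf <-]; split=> //; apply: hGX hf.
- by move=> _ [f /hR hf <-]; split=> //; apply: hGX hf.
- by move=> _ [] [f hf <-]; apply: hS; [left | right].
move=> _ [] [[f hf <-] hg]; have [_ _ h1 h2] := hspec f.
  by exists (true, f) => //; apply/h1.
by exists (false, f) => //; apply/h2.
Qed.
End Rules.
End Instances.

(** * Parsing *)

Lemma pos_bits_inj : injective pos_bits.
Proof. by elim=> [p IH|p IH|] [q|q|] //= [/IH->]. Qed.

Lemma nat_bits_inj : injective nat_bits.
Proof. by move=> m n /pos_bits_inj/Pnat.SuccNat2Pos.inj. Qed.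

Lemma nat_bits_map n : exists u, nat_bits n = map Bit u.
Proof.
rewrite /nat_bits; elim: (Pos.of_succ_nat n) => [p [u hu]|p [u hu]|] /=.
- by exists (true :: u); rewrite hu.
- by exists (false :: u); rewrite hu.
by exists [::].
Qed.

(** Every digit string, even the empty one, denotes an index, so the parser has nothing to check at
    a variable. *)
Lemma nat_bits_surj u : exists n, nat_bits n = map Bit u.
Proof.
suff [p hp] : exists p, pos_bits p = map Bit u.
  have [n hn] := Pnat.Pos2Nat.is_succ p.
  by exists n; rewrite /nat_bits (Pnat.SuccNat2Pos.inv n p hn).
elim: u => [|[] u [p hp]]; first by exists xH.
  by exists (xI p); rewrite /= hp.
by exists (xO p); rewrite /= hp.
Qed.

Definition dbits (n : nat) : data := dl [seq dtok t | t <- nat_bits n].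

Lemma dl_inj : injective dl. Proof. exact: can_inj dlK. Qed.

Lemma dbits_inj : injective dbits.
Proof. by move=> m n /dl_inj/(inj_map dtok_inj)/nat_bits_inj. Qed.

Section Rep.
Variable S : signature.

Fixpoint rep (f : form S) : data :=
  match f with
  | Var p => Cons Nil (dbits p)
  | App c a => Cons (db true)
      (Cons (dbits (pickle c)) (dl [seq rep (a i) | i <- enum 'I_(ar c)]))
  end.

Lemma rep_inj : injective rep.
Proof.
elim=> [p|c a IH] [q|d b] //= []; first by move=> /dbits_inj->.
move=> /dbits_inj/(pcan_inj pickleK) e; case: d / e b => b /dl_inj h.
congr App; apply: funext => i; apply: IH.
have : i \in enum 'I_(ar c) by rewrite mem_enum.
by move/eq_in_map: h; apply.
Qed.
End Rep.

Definition mk (b c k t : data) : data := Cons b (Cons c (Cons k t)).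

(* The state of a shift-reduce parser reading the word from right to left:
   digits read so far, formulas of the current list, stack of the interrupted
   lists with the token that interrupted them, and all formulas found.  [Nil]
   is the error state; [ok] checks the arities. *)
Definition pstep (ok : data -> bool) (t s : data) : data :=
  let b := hd s in let c := hd (tl s) in let k := hd (tl (tl s)) in
  let T := tl (tl (tl s)) in
  if s == Nil then Nil
  else if (t == dtok (Bit true)) || (t == dtok (Bit false)) then
    mk (Cons t b) c k T
  else if t == dtok TVar then
    mk Nil (Cons (Cons Nil b) c) k (Cons (Cons Nil b) T)
  else if t == dtok TOpen then
    if (hd (hd k) == dtok TClose) && ok (Cons b c) then
      mk Nil (Cons (Cons (db true) (Cons b c)) (tl (hd k))) (tl k)
        (Cons (Cons (db true) (Cons b c)) T)
    else Nil
  else if (t == dtok TClose) || (t == dtok TSep) then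
    if b == Nil then mk Nil Nil (Cons (Cons t c) k) T else Nil
  else Nil.

Definition pinit : data := mk Nil Nil Nil Nil.

Definition core (s : data) : nat := sz (hd s) + sz (hd (tl s)) + sz (hd (tl (tl s))).

Lemma sz_hd_tl d : sz (hd d) + sz (tl d) <= (sz d).+1.
Proof. by case: d => //= a b; rewrite sz_Cons; lia. Qed.

Lemma sz_tl d : sz (tl d) <= sz d.
Proof. by case: d => //= a b; rewrite sz_Cons; lia. Qed.

Lemma sz_dtok t : sz (dtok t) <= 11.
Proof. by case: t => [[]||||]. Qed.

(** The first three components mostly rearrange their contents and grow by a bounded amount per
    token. The list of all formulas found receives a copy of a part of them, so its growth per token
    is linear and its final size quadratic. *)
Lemma pstep_size ok t s :
  core (pstep ok t s) <= core s + 20 /\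
  sz (tl (tl (tl (pstep ok t s)))) <= sz (tl (tl (tl s))) + core s + 20.
Proof.
rewrite /pstep; case: eqP => [->|_] //.
have sN : sz Nil = 1 by [].
have h1 := sz_hd_tl (hd (tl (tl s))).
have h2 := sz_hd_tl (hd (hd (tl (tl s)))).
case: ifP => [/orP ht|_].
  have : sz t <= 11 by case: ht => /eqP ->; apply: sz_dtok.
  by rewrite /core /mk /= !sz_Cons; lia.
case: ifP => _; first by rewrite /core /mk /= !sz_Cons sN; lia.
case: ifP => _.
  case: ifP => _; last by rewrite /core /= sN; split; lia.
  by rewrite /core /mk /= !sz_Cons sN; lia.
case: ifP => [/orP ht|_]; last by rewrite /core /= sN; split; lia.
have : sz t <= 11 by case: ht => /eqP ->; apply: sz_dtok.
case: ifP => _; last by rewrite /core /= sN; split; lia.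
by rewrite /core /mk /= !sz_Cons sN; lia.
Qed.

Definition parse (ok : data -> bool) (d : data) : data :=
  foldl (fun s t => pstep ok t s) pinit (undl d).

Lemma parse_size ok ts :
  sz (foldl (fun s t => pstep ok t s) pinit ts) <=
  (20 * size ts + 3) + (1 + size ts * (20 * size ts + 23)) + 3.
Proof.
set s := foldl _ _ _.
have [hc ht] : core s <= 20 * size ts + 3 /\
    sz (tl (tl (tl s))) <= 1 + size ts * (20 * size ts + 23).
  rewrite /s; elim/last_ind: ts {s} => [|ts t [IH1 IH2]] //.
  rewrite -cats1 foldl_cat size_cat /=.
  by have [h1 h2] := pstep_size ok t (foldl (fun s t => pstep ok t s) pinit ts); split; nia.
have : sz s <= core s + sz (tl (tl (tl s))) + 3.
  have e d : sz d <= sz (hd d) + sz (tl d) + 1.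
    by case: d => //= a b; rewrite sz_Cons; lia.
  by have := e s; have := e (tl s); have := e (tl (tl s)); rewrite /core; lia.
lia.
Qed.

Lemma FP_parse ok f : FP (fun z => db (ok z)) -> FP f -> FP (fun x => parse ok (f x)).
Proof.
move=> hok hf; have [c hc] := FP_size hf.
apply: (@FP_fold f (fun=> pinit) (fun _ a acc => pstep ok a acc)
  (fun n => (20 * poly_bound c n + 3) + (1 + poly_bound c n * (20 * poly_bound c n + 23)) + 3)) => //.
- exact: FP_const.
- rewrite /pstep /mk.
  have hB g a : FP g -> FP (fun x => db (g x == a)).
    by move=> hg; apply: FP_eq => //; apply: FP_const.
  have hok' g : FP g -> FP (fun x => db (ok (g x)))
    by move=> hg; exact: (@FP_comp _ g hok hg).
  apply: FP_if; [apply: hB; fp | fp |].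
  apply: FP_if; [apply: FP_or; apply: hB; fp | fp |].
  apply: FP_if; [apply: hB; fp | fp |].
  apply: FP_if; [apply: hB; fp | |].
    apply: FP_if; [apply: FP_and; [apply: hB; fp | apply: hok'; fp] | fp | fp].
  apply: FP_if; [apply: FP_or; apply: hB; fp | | fp].
  by apply: FP_if; [apply: hB; fp | fp | fp].
- by pb.
move=> x s1 s2 hs; apply: leq_trans (parse_size _ _) _.
have : size s1 <= poly_bound c (sz x).
  apply: leq_trans (hc x); apply: leq_trans (size_le_sz _); rewrite hs size_cat; lia.
by nia.
Qed.

Lemma pstep_mk ok t b c k T : pstep ok (dtok t) (mk b c k T) =
  match t with
  | Bit _ => mk (Cons (dtok t) b) c k T
  | TVar => mk Nil (Cons (Cons Nil b) c) k (Cons (Cons Nil b) T)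
  | TOpen =>
      if (hd (hd k) == dtok TClose) && ok (Cons b c) then
        mk Nil (Cons (Cons (db true) (Cons b c)) (tl (hd k))) (tl k)
          (Cons (Cons (db true) (Cons b c)) T)
      else Nil
  | TClose | TSep =>
      if b == Nil then mk Nil Nil (Cons (Cons (dtok t) c) k) T else Nil
  end.
Proof.
rewrite /pstep !(inj_eq dtok_inj); have -> : (mk b c k T == Nil) = false by apply/eqP.
by case: t => [[]||||].
Qed.

Lemma pstep_Nil ok t : pstep ok t Nil = Nil.
Proof. by rewrite /pstep eqxx. Qed.

Section Parser.
Variables (S : signature) (ok : data -> bool).

Notation reps s := (dl [seq @rep S f | f <- s]).
Notation run := (foldr (fun t s => pstep ok (dtok t) s)).

Definition sequent_word (s1 s2 s3 s4 : seq (form S)) : seq token :=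
  enc_forms s1 ++ TSep :: enc_forms s2 ++ TSep ::
  enc_forms s3 ++ TSep :: enc_forms s4.

Definition stack (s2 s3 s4 : seq (form S)) : data :=
  dl [seq Cons (dtok TSep) (reps s) | s <- [:: s2; s3; s4]].

Lemma run_bits u b c k T :
  run (mk (dl b) c k T) (map Bit u) = mk (dl ([seq dtok (Bit x) | x <- u] ++ b)) c k T.
Proof. by elim: u => //= x u ->; rewrite pstep_mk. Qed.

Lemma run_nat_bits n c k T : run (mk Nil c k T) (nat_bits n) = mk (dbits n) c k T.
Proof.
rewrite /dbits; have [u ->] := nat_bits_map n.
by rewrite (run_bits u [::]) cats0 -map_comp.
Qed.

Section Complete.
Hypothesis ok_node : forall (c : con S) (a : 'I_(ar c) -> form S),
  ok (Cons (dbits (pickle c)) (dl [seq rep (a i) | i <- enum 'I_(ar c)])).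

(** The index type is arbitrary so that the lemma serves both the arguments of a connective, where
    the hypothesis is the induction hypothesis, and the lists of a sequent. *)
Lemma run_forms_aux (I : Type) (s : seq I) (a : I -> form S) c k T :
  (forall i c k T, run (mk Nil (dl c) k (dl T)) (enc_form (a i)) =
     mk Nil (dl (rep (a i) :: c)) k (dl ([seq rep g | g <- subl (a i)] ++ T))) ->
  run (mk Nil (dl c) k (dl T)) (flatten [seq enc_form (a i) | i <- s]) =
  mk Nil (dl ([seq rep (a i) | i <- s] ++ c)) k
    (dl ([seq rep g | g <- flatten [seq subl (a i) | i <- s]] ++ T)).
Proof.
by move=> h; elim: s => //= i s IH; rewrite foldr_cat IH h map_cat catA.
Qed.

Lemma run_form (f : form S) c k T :
  run (mk Nil (dl c) k (dl T)) (enc_form f) =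
  mk Nil (dl (rep f :: c)) k (dl ([seq rep g | g <- subl f] ++ T)).
Proof.
elim: f c k T => [p|o a IH] c k T; first by rewrite /= run_nat_bits pstep_mk.
rewrite /= !foldr_cat /= pstep_mk eqxx.
rewrite (run_forms_aux _ [::]) // cats0 run_nat_bits pstep_mk /= eqxx ok_node.
by [].
Qed.

Lemma run_forms s c k T :
  run (mk Nil (dl c) k (dl T)) (enc_forms s) =
  mk Nil (dl (map (@rep S) s ++ c)) k
    (dl ([seq rep g | g <- flatten (map (@subl S) s)] ++ T)).
Proof. by rewrite /enc_forms run_forms_aux //; move=> *; apply: run_form. Qed.

Lemma run_sequent s1 s2 s3 s4 :
  run pinit (sequent_word s1 s2 s3 s4) =
  mk Nil (reps s1) (stack s2 s3 s4)
    (reps (flatten (map (@subl S) (s1 ++ s2 ++ s3 ++ s4)))).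
Proof.
rewrite /sequent_word.
do 3! rewrite foldr_cat [foldr _ _ (_ :: _)]/=.
rewrite (run_forms _ [::] _ [::]) pstep_mk eqxx (run_forms _ [::]) pstep_mk eqxx.
rewrite (run_forms _ [::]) pstep_mk eqxx (run_forms _ [::]) !cats0.
by rewrite !map_cat !flatten_cat !map_cat.
Qed.
End Complete.

Definition valid (s : data) : bool :=
  let k := hd (tl (tl s)) in
  [&& s != Nil, hd s == Nil, hd (hd k) == dtok TSep, hd (hd (tl k)) == dtok TSep,
      hd (hd (tl (tl k))) == dtok TSep & tl (tl (tl k)) == Nil].

Lemma valid_mk c s2 s3 s4 T : valid (mk Nil c (stack s2 s3 s4) T).
Proof. by rewrite /valid /= !eqxx !andbT; apply/eqP. Qed.

Section Sound.
Hypothesis okP : forall z, ok z ->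
  exists2 c : con S, hd z = dbits (pickle c) & size (undl (tl z)) = ar c.

Definition frame (ml : token * seq (form S)) : data := Cons (dtok ml.1) (reps ml.2).
Definition frame_word (ml : token * seq (form S)) : seq token :=
  ml.1 :: enc_forms ml.2.

Lemma enc_forms_cons (f : form S) s : enc_forms (f :: s) = enc_form f ++ enc_forms s.
Proof. by []. Qed.

(** Soundness as an invariant: outside the error state, the first three components determine the
    part of the word already read. The last one is never inspected by the parser and stays
    arbitrary. *)
Lemma run_inv w : run pinit w != Nil -> exists u c (k : seq (token * seq (form S))) T,
  run pinit w = mk (dl [seq dtok (Bit x) | x <- u]) (reps c) (dl (map frame k)) T /\
  w = map Bit u ++ enc_forms c ++ flatten (map frame_word k).
Proof.
elim: w => [|t w IH] /=.
  by move=> _; exists [::], [::], [::], Nil.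
have [->|/IH[u [c [k [T [-> ->]]]]]] := eqVneq (run pinit w) Nil.
  by rewrite pstep_Nil eqxx.
have hu : (dl [seq dtok (Bit x) | x <- u] == Nil) = (u == [::]).
  by case: u => [|b u] /=; rewrite ?eqxx //; apply/eqP.
rewrite pstep_mk; case: t => [b||||] h.
- by exists (b :: u), c, k; eexists.
- have [p hp] := nat_bits_surj u.
  exists [::], (Var p :: c), k; eexists; split.
    by rewrite /= /dbits hp -map_comp; reflexivity.
  by rewrite enc_forms_cons /= hp -catA.
- move: h; case: ifP => [/andP[hk /okP[o /= ho hs]] _|_]; last by rewrite eqxx.
  case: k hk => [/eqP/(@dtok_inj TVar)//|[m l] k] /= /eqP/dtok_inj->.
  have [p hp] := nat_bits_map (pickle o).
  have eu : u = p.
    move: ho; rewrite /dbits hp -map_comp => /dl_inj.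
    by apply: inj_map => x y /dtok_inj[].
  rewrite dlK size_map in hs.
  (* By the arity check [c] has exactly [ar o] elements, so it is the list of arguments of the new
     formula and the default [Var 0] is never reached. *)
  have hc (A : Type) (g : form S -> A) :
      [seq g (nth (Var 0) c i) | i : 'I_(ar o) <- enum 'I_(ar o)] = map g c.
    rewrite -[c in RHS](mkseq_nth (Var 0)) hs /mkseq -val_enum_ord.
    by rewrite -!map_comp.
  exists [::], (App o (fun i => nth (Var 0) c i) :: l), k; eexists; split.
    by rewrite /= hc ho; reflexivity.
  rewrite enc_forms_cons /= hc hp eu /enc_forms -!catA /=; congr (_ :: _).
- move: h; rewrite hu; have [-> _|_] := eqVneq u [::]; last by rewrite eqxx.
  by exists [::], [::], ((TClose, c) :: k); eexists; split; first by reflexivity.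
move: h; rewrite hu; have [-> _|_] := eqVneq u [::]; last by rewrite eqxx.
by exists [::], [::], ((TSep, c) :: k); eexists; split; first by reflexivity.
Qed.

Lemma run_valid w : valid (run pinit w) ->
  exists s1 s2 s3 s4, w = sequent_word s1 s2 s3 s4.
Proof.
rewrite /valid => /and5P[/run_inv[u [c [k [T [-> ->]]]]] /= hu h2 h3 /andP[h4 h5]].
case: u hu => [_|b u /eqP//].
case: k h2 h3 h4 h5 => [|[m2 s2] [|[m3 s3] [|[m4 s4] [|m5 k]]]] /=;
  do ?[by move/eqP/(@dtok_inj TVar) | by move=> _ /eqP/(@dtok_inj TVar)
      | by move=> _ _ /eqP/(@dtok_inj TVar) | by move=> _ _ _ /eqP].
move=> /eqP/dtok_inj -> /eqP/dtok_inj -> /eqP/dtok_inj -> _.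
by exists c, s2, s3, s4; rewrite /sequent_word cats0.
Qed.
End Sound.
End Parser.

(** * The verifier *)

(** Lists such as those of the rules, of [L] or of the arguments of a connective do not depend on
    the input; a loop over such a list is unrolled in the program. *)
Lemma FP_seq (I : Type) (s : seq I) (h : I -> data -> data) :
  (forall i, FP (h i)) -> FP (fun x => dl [seq h i x | i <- s]).
Proof.
by move=> hh; elim: s => [|i s IH] /=; [apply: FP_const | apply: FP_Cons].
Qed.

Lemma FP_all_seq (I : Type) (s : seq I) (p : I -> data -> bool) :
  (forall i, FP (fun x => db (p i x))) -> FP (fun x => db (all (p^~ x) s)).
Proof.
by move=> hp; elim: s => [|i s IH] /=; [apply: FP_const | apply: FP_and].
Qed.

Lemma FP_has_seq (I : Type) (s : seq I) (p : I -> data -> bool) :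
  (forall i, FP (fun x => db (p i x))) -> FP (fun x => db (has (p^~ x) s)).
Proof.
by move=> hp; elim: s => [|i s IH] /=; [apply: FP_const | apply: FP_or].
Qed.

Lemma FP_iter_tl n f : FP f -> FP (fun x => iter n tl (f x)).
Proof. by move=> hf; elim: n => //= n IH; apply: FP_tl. Qed.

Lemma FP_eq_const f d : FP f -> FP (fun x => db (f x == d)).
Proof. by move=> hf; apply: FP_eq => //; apply: FP_const. Qed.

Lemma FP_size_eq n f : FP f -> FP (fun x => db (size (undl (f x)) == n)).
Proof.
elim: n f => [|n IH] f hf.
  apply: eq_FP (FP_eq_const Nil hf) => x; congr db.
  by case: (f x) => [|a b]; rewrite ?eqxx //; apply/eqP.
apply: eq_FP (FP_and (FP_not (FP_eq_const Nil hf)) (IH _ (FP_tl hf))) => x.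
congr db; case: (f x) => [|a b] /=; first by rewrite eqxx.
by rewrite eqSS; have -> : (Cons a b == Nil) = false by apply/eqP.
Qed.

Fixpoint dtuples (K : nat) (l : data) : data :=
  if K is K'.+1 then
    dl (flatten [seq undl (dl [seq Cons a e | e <- undl (dtuples K' l)]) | a <- undl l])
  else dl [:: Nil].

(** Polynomial because [K] is fixed: it is the depth of nesting of loops in the program. *)
Lemma FP_dtuples K f : FP f -> FP (fun x => dtuples K (f x)).
Proof.
move=> hf; elim: K => [|K IH] /=; first exact: FP_const.
apply: (@FP_flatmap (fun x a => dl [seq Cons a e | e <- undl (dtuples K (f x))])) => //.
apply: (@FP_map (fun w e => Cons (tl w) e)); first by fp.
by apply: (FP_comp IH); fp.
Qed.

Lemma dtuples_dl K s : dtuples K (dl s) = dl (map dl (tuples K s)).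
Proof.
elim: K => //= K ->; rewrite !dlK; congr dl; rewrite map_flatten -map_comp.
by congr flatten; apply: eq_map => a /=; rewrite dlK -!map_comp.
Qed.

Definition dsign (b : bool) (l : data) : data := dl [seq Cons (db b) a | a <- undl l].

Lemma FP_dsign b f : FP f -> FP (fun x => dsign b (f x)).
Proof. by move=> hf; apply: (@FP_map (fun _ a => Cons (db b) a)) => //; fp. Qed.

Definition both_signs (l : data) : data :=
  dl (undl (dsign true l) ++ undl (dsign false l)).

Lemma FP_both_signs f : FP f -> FP (fun x => both_signs (f x)).
Proof. by move=> hf; apply: FP_cat; apply: FP_dsign. Qed.

Definition mask_step (acc a : data) : data :=
  Cons (tl (hd acc)) (if hd (hd acc) == db true then Cons a (tl acc) else tl acc).

(** Selects the elements of [l] at the positions where [u] has a true bit. A mask that is too short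
    selects nothing further, so every word is a legitimate certificate. *)
Definition dmask (u l : data) : data :=
  tl (foldl mask_step (Cons u Nil) (undl l)).

Lemma FP_dmask f g : FP f -> FP g -> FP (fun x => dmask (f x) (g x)).
Proof.
move=> hf hg; apply: FP_tl.
apply: (@FP_fold_lin g (fun x => Cons (f x) Nil) (fun _ a acc => mask_step acc a)
  (fun n => n + 3)) => //.
- by fp.
- rewrite /mask_step; apply: FP_Cons; first by fp.
  by apply: FP_if; [apply: FP_eq_const; fp | fp | fp].
- by pb.
move=> x a acc; rewrite /mask_step sz_Cons.
have := sz_hd_tl acc; have := sz_tl (hd acc).
by case: ifP => _; rewrite ?sz_Cons; lia.
Qed.

Lemma dmask_filter (q : data -> bool) s :
  dmask (dl [seq db (q y) | y <- s]) (dl s) = dl (rev (filter q s)).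
Proof.
rewrite /dmask dlK.
suff H o : foldl mask_step (Cons (dl [seq db (q y) | y <- s]) (dl o)) s =
    Cons Nil (dl (catrev (filter q s) o)) by rewrite (H [::]).
elim: s o => //= y s IH o; rewrite [mask_step (Cons _ _) _]/mask_step /=.
case: (q y) => /=; first by rewrite eqxx; exact: (IH (y :: o)).
by case: eqP => // _; exact: IH.
Qed.

Section Verifier.
Variables (S : signature) (L : seq (form S)) (K : nat) (R : seq (rule S)).
Variable ok : data -> bool.
Hypothesis FP_ok : FP (fun z => db (ok z)).

Notation reps s := (dl [seq @rep S f | f <- s]).
Notation run := (foldr (fun t s => pstep ok (dtok t) s)).

(** The test against [Nil] detects the end of the list of values and reproduces the default [Var 0]
    of [nth]. *)
Fixpoint instd (f : form S) (e : data) : data :=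
  match f with
  | Var p => if iter p tl e == Nil then rep (@Var S 0) else hd (iter p tl e)
  | App c a => Cons (db true)
      (Cons (dbits (pickle c)) (dl [seq instd (a i) e | i <- enum 'I_(ar c)]))
  end.

Lemma FP_instd f g : FP g -> FP (fun x => instd f (g x)).
Proof.
move=> hg; elim: f => [p|c a IH] /=.
  have h := FP_iter_tl p hg.
  by apply: FP_if; [apply: FP_eq_const | apply: FP_const | apply: FP_hd].
do 2 (apply: FP_Cons; first exact: FP_const).
exact: (@FP_seq _ (enum 'I_(ar c)) (fun i x => instd (a i) (g x))).
Qed.

Lemma iter_tl_dl p s : iter p tl (dl s) = dl (drop p s).
Proof.
elim: p => [|p IH]; first by rewrite drop0.
by rewrite iterS IH tl_dl -drop1 drop_drop add1n.
Qed.

Lemma instd_rep f e : instd f (reps e) = rep (subst (nth (Var 0) e) f).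
Proof.
elim: f => [p|c a IH] /=.
  rewrite iter_tl_dl -map_drop; have [lt|ge] := ltnP p (size e).
    by rewrite (drop_nth (Var 0) lt) /=; case: eqP.
  by rewrite drop_oversize // eqxx nth_default.
by congr (Cons _ (Cons _ (dl _))); apply: eq_map => i; apply: IH.
Qed.

Definition dinsts (T : data) : data :=
  dl (flatten [seq undl (dl [seq instd f e | e <- undl (dtuples K T)]) | f <- L]).

Lemma FP_dinsts g : FP g -> FP (fun x => dinsts (g x)).
Proof.
move=> hg; rewrite /dinsts; elim: L => [|f s IH] /=; first exact: FP_const.
have hf : FP (fun x => dl [seq instd f e | e <- undl (dtuples K (g x))]).
  by apply: (@FP_map (fun _ e => instd f e)); [apply: FP_instd; fp | apply: FP_dtuples].
apply: eq_FP (FP_cat hf IH) => x; by rewrite !dlK.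
Qed.

Lemma dinsts_rep T : dinsts (reps T) = reps (insts L T K).
Proof.
rewrite /dinsts /insts dtuples_dl map_tuples dlK map_flatten; congr (dl (flatten _)).
rewrite -[RHS]map_comp; apply: eq_map => f /=; rewrite dlK -!map_comp.
by apply: eq_map => e /=; apply: instd_rep.
Qed.

Definition state_of (z : data) : data := parse ok (tl z).
Definition universe (z : data) : data :=
  dinsts (Cons (rep (@Var S 0)) (tl (tl (tl (state_of z))))).
Definition guess (z : data) : data := dmask (hd z) (both_signs (universe z)).
Definition list1 (z : data) : data := hd (tl (state_of z)).
(** The indices 0, 1, 2 give the nonaccepted, rejected and nonrejected formulas: these lists were
    interrupted by the separators and lie on the stack in the order of the encoding. *)
Definition list_of (n : nat) (z : data) : data :=
  tl (hd (iter n tl (hd (tl (tl (state_of z)))))).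

Definition rule_ok (z e : data) (ac : rule S) : bool :=
  all (fun bf => Cons (db bf.1) (instd bf.2 e) \in undl (guess z)) ac.1 ==>
  all (fun bf => instd bf.2 e \in undl (universe z)) ac.2 ==>
  has (fun bf => Cons (db bf.1) (instd bf.2 e) \in undl (guess z)) ac.2.

Definition refutes (z : data) : bool :=
  [&& all (fun a => Cons (db true) a \in undl (guess z)) (undl (list1 z)),
      all (fun a => Cons (db false) a \in undl (guess z)) (undl (list_of 1 z)),
      all (fun a => Cons (db true) a \notin undl (guess z)) (undl (list_of 0 z)),
      all (fun a => Cons (db false) a \notin undl (guess z)) (undl (list_of 2 z)) &
      all (fun e => all (rule_ok z e) R) (undl (dtuples K (universe z)))].

(** A word on which the parser fails encodes no B-sequent; it belongs to the complement and is
    accepted with any certificate. *)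
Definition verify (z : data) : bool := valid (state_of z) ==> refutes z.

Lemma FP_state_of : FP state_of.
Proof. by apply: FP_parse => //; fp. Qed.

Lemma FP_universe : FP universe.
Proof. by apply: FP_dinsts; have h := FP_state_of; fp. Qed.

Lemma FP_guess : FP guess.
Proof. by apply: FP_dmask; [fp | apply/FP_both_signs/FP_universe]. Qed.

Lemma FP_valid f : FP f -> FP (fun x => db (valid (f x))).
Proof.
move=> hf; rewrite /valid.
by repeat (apply: FP_and; first (try apply: FP_not); first by apply: FP_eq_const; fp);
  apply: FP_eq_const; fp.
Qed.

Lemma FP_rule_ok ac : FP (fun w => db (rule_ok (hd w) (tl w) ac)).
Proof.
have hG : FP (fun w => guess (hd w)) by apply: (FP_comp FP_guess); fp.
have hU : FP (fun w => universe (hd w)) by apply: (FP_comp FP_universe); fp.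
have hi f : FP (fun w => instd f (tl w)) by apply: FP_instd; fp.
apply: FP_imp; [|apply: FP_imp].
- apply: (@FP_all_seq _ _ (fun bf w => Cons (db bf.1) (instd bf.2 (tl w)) \in undl (guess (hd w)))).
  by move=> bf; apply: FP_mem => //; apply: FP_Cons => //; apply: FP_const.
- apply: (@FP_all_seq _ _ (fun bf w => instd bf.2 (tl w) \in undl (universe (hd w)))).
  by move=> bf; apply: FP_mem.
apply: (@FP_has_seq _ _ (fun bf w => Cons (db bf.1) (instd bf.2 (tl w)) \in undl (guess (hd w)))).
by move=> bf; apply: FP_mem => //; apply: FP_Cons => //; apply: FP_const.
Qed.

Lemma FP_list_of n : FP (list_of n).
Proof.
by apply: FP_tl; apply: FP_hd; apply: FP_iter_tl; have h := FP_state_of; fp.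
Qed.

Lemma FP_verify : FP (fun z => db (verify z)).
Proof.
have hG b : FP (fun w => db (Cons (db b) (tl w) \in undl (guess (hd w)))).
  apply: FP_mem; first by apply: FP_Cons; [exact: FP_const | fp].
  by apply: (FP_comp FP_guess); fp.
have h1 : FP list1 by have := FP_state_of; rewrite /list1 => h; fp.
apply: FP_imp; first exact: FP_valid FP_state_of.
apply: FP_and; first exact: (@FP_all (fun z a => Cons (db true) a \in undl (guess z))).
apply: FP_and.
  by apply: (@FP_all (fun z a => Cons (db false) a \in undl (guess z))) => //; apply: FP_list_of.
apply: FP_and.
  apply: (@FP_all (fun z a => Cons (db true) a \notin undl (guess z))); last exact: FP_list_of.
  exact: FP_not.
apply: FP_and.
  apply: (@FP_all (fun z a => Cons (db false) a \notin undl (guess z))); last exact: FP_list_of.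
  exact: FP_not.
apply: (@FP_all (fun z e => all (rule_ok z e) R)); last exact: FP_dtuples FP_universe.
by apply: (@FP_all_seq _ _ (fun ac w => rule_ok (hd w) (tl w) ac)) => ac; apply: FP_rule_ok.
Qed.
End Verifier.

(** The loader has reversed the tokens, so a left fold over them reads the word from right to
    left. *)
Lemma state_ofE ok w u :
  state_of ok (input_data w u) = foldr (fun t s => pstep ok (dtok t) s) pinit w.
Proof. by rewrite /state_of /parse /= dlK foldl_rev foldr_map. Qed.

(** * Correctness of the verifier on encodings of sequents *)

Section Correctness.
Variables (S : signature) (L : seq (form S)) (K : nat) (R : seq (rule S)).
Variable ok : data -> bool.
Hypothesis ok_node : forall (c : con S) (a : 'I_(ar c) -> form S),
  ok (Cons (dbits (pickle c)) (dl [seq rep (a i) | i <- enum 'I_(ar c)])).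
Variables s1 s2 s3 s4 : seq (form S).

Notation w := (sequent_word s1 s2 s3 s4).
Notation reps s := (dl [seq @rep S f | f <- s]).

Definition search_space : seq (form S) :=
  insts L (closure (s1 ++ s2 ++ s3 ++ s4)) K.

Definition sequent : bstatement S :=
  BStatement [set f | f \in s1] [set f | f \in s2] [set f | f \in s3] [set f | f \in s4].

Lemma universe_word u : universe L K ok (input_data w u) = reps search_space.
Proof. by rewrite /universe state_ofE run_sequent //= -(dinsts_rep _ _ (_ :: _)). Qed.

Lemma valid_word u : valid (state_of ok (input_data w u)).
Proof. by rewrite state_ofE run_sequent //; apply: valid_mk. Qed.

Variable u : seq bool.
Let z := input_data w u.

Definition guessed (b : bool) (f : form S) : Prop :=
  Cons (db b) (rep f) \in undl (guess L K ok z).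

Lemma refutesP : refutes L K R ok z <->
  separates sequent guessed /\ closed_under R search_space K guessed.
Proof.
have hs : state_of ok z = _ := state_ofE _ _ _; rewrite run_sequent // in hs.
have l1 : list1 ok z = reps s1 by rewrite /list1 hs.
have l2 : list_of ok 0 z = reps s2 by rewrite /list_of hs.
have l3 : list_of ok 1 z = reps s3 by rewrite /list_of hs.
have l4 : list_of ok 2 z = reps s4 by rewrite /list_of hs.
have hrule e ac : rule_ok L K ok z (reps e) ac <->
    ((forall bf, bf \in ac.1 -> guessed bf.1 (subst (nth (Var 0) e) bf.2)) ->
    (forall bf, bf \in ac.2 -> subst (nth (Var 0) e) bf.2 \in search_space) ->
    exists2 bf, bf \in ac.2 & guessed bf.1 (subst (nth (Var 0) e) bf.2)).
  rewrite /rule_ok universe_word dlK; split.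
    move=> /implyP h ha hc; have := h _; case/(_ _)/implyP/(_ _)/hasP => //.
    - by apply/allP => bf /ha; rewrite instd_rep.
    - by apply/allP => bf /hc hbf; rewrite instd_rep; apply: map_f.
    by move=> bf hbf; rewrite instd_rep => hg; exists bf.
  move=> h; apply/implyP => /allP ha; apply/implyP => /allP hc; apply/hasP.
  have [bf hbf|bf hbf|bf hbf hg] := h _ _.
  - by have := ha _ hbf; rewrite instd_rep.
  - by have := hc _ hbf; rewrite instd_rep (mem_map (@rep_inj S)).
  by exists bf; rewrite // instd_rep.
have hall b s : all (fun a => Cons (db b) a \in undl (guess L K ok z)) (undl (reps s)) <->
    forall f, f \in s -> guessed b f.
  rewrite dlK all_map; split=> [/allP h f /h //|h]; apply/allP => f /h //.
have hnone b s : all (fun a => Cons (db b) a \notin undl (guess L K ok z)) (undl (reps s)) <->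
    forall f, f \in s -> ~ guessed b f.
  rewrite dlK all_map; split=> [/allP h f /h /negP //|h]; apply/allP => f /h /negP //.
have tuplesE : undl (dtuples K (universe L K ok z)) =
    [seq reps e | e <- tuples K search_space].
  by rewrite universe_word dtuples_dl map_tuples dlK -map_comp.
rewrite /refutes l1 l2 l3 l4 tuplesE.
split.
  case/and5P=> /hall h1 /hall h2 /hnone h3 /hnone h4 /allP h5; split; first by split.
  move=> ac e hac he; apply/hrule.
  have /allP : all (rule_ok L K ok z (reps e)) R by apply: h5; apply: map_f.
  exact.
case=> [[h1 h2 h3 h4] h5]; apply/and5P; split.
- exact/hall.
- exact/hall.
- exact/hnone.
- exact/hnone.
apply/allP => _ /mapP[e he ->]; apply/allP => ac hac /=.
by apply/hrule; apply: h5.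
Qed.
End Correctness.

(** * Words, sequents and the complexity bound *)

Lemma lists_mem (S : signature) (s : seq (form S)) X :
  lists s X <-> X = [set f | f \in s].
Proof.
have h f : List.In f s <-> f \in s.
  elim: s => //= g s IH; rewrite inE eq_sym; split.
    by case=> [->|/IH->]; rewrite ?eqxx ?orbT.
  by case/orP=> [/eqP|/IH]; [left | right].
have -> : [set f | f \in s] = [set f | List.In f s].
  by apply/seteqP; split=> f /= /h.
by [].
Qed.

Section Problem.
Variables (S : signature) (C : set (schema S)) (Lambda : set (form S)).
Hypothesis finite_calculus : finite_set C.
Hypothesis finitary_calculus : forall r, C r -> finitary r.
Hypothesis finite_Lambda : finite_set Lambda.
Hypothesis analytic_calculus : analytic Lambda C.

Lemma encodesP (w : seq token) (Phi : bstatement S) :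
  encodes w Phi <-> exists s1 s2 s3 s4,
    w = sequent_word s1 s2 s3 s4 /\ Phi = sequent s1 s2 s3 s4.
Proof.
split.
  case=> s1 [s2 [s3 [s4 [/lists_mem h1 /lists_mem h2 /lists_mem h3 /lists_mem h4 ->]]]].
  exists s1, s2, s3, s4; split=> //.
  by case: Phi h1 h2 h3 h4 => ? ? ? ? /= -> -> -> ->.
case=> s1 [s2 [s3 [s4 [-> ->]]]]; exists s1, s2, s3, s4.
by split=> //; apply/lists_mem.
Qed.

Lemma sequent_bsequent (s1 s2 s3 s4 : seq (form S)) :
  is_bsequent (sequent s1 s2 s3 s4).
Proof. by split; apply: finite_seq. Qed.

(** The parser without arity checks returns the four lists, so it is a left inverse of the encoding
    up to [rep]. *)
Lemma sequent_word_inj (s1 s2 s3 s4 t1 t2 t3 t4 : seq (form S)) :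
  sequent_word s1 s2 s3 s4 = sequent_word t1 t2 t3 t4 ->
  sequent s1 s2 s3 s4 = sequent t1 t2 t3 t4.
Proof.
move=> /(congr1 (foldr (fun t s => pstep xpredT (dtok t) s) pinit)).
rewrite !run_sequent // /stack /= => -[].
have inj := inj_map (@rep_inj S).
by move=> /dl_inj/inj-> /dl_inj/inj-> /dl_inj/inj-> /dl_inj/inj->.
Qed.

Lemma provable_wordsP (s1 s2 s3 s4 : seq (form S)) :
  provable_words C (sequent_word s1 s2 s3 s4) <-> provable C (sequent s1 s2 s3 s4).
Proof.
split=> [[Phi [_ /encodesP[t1 [t2 [t3 [t4 [/sequent_word_inj-> ->]]]]]]] //|h].
exists (sequent s1 s2 s3 s4); split=> //; first exact: sequent_bsequent.
by apply/encodesP; exists s1, s2, s3, s4.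
Qed.

(** Common to the problem restricted to encodings and to the one on all words: [ok] has to be strict
    enough only to reject the ill-formed words that belong to [D]. *)
Lemma coNP_of_parser (D : set (seq token)) ok :
  FP (fun z => db (ok z)) ->
  (forall (c : con S) (a : 'I_(ar c) -> form S),
    ok (Cons (dbits (pickle c)) (dl [seq rep (a i) | i <- enum 'I_(ar c)]))) ->
  (forall w, D w -> valid (foldr (fun t s => pstep ok (dtok t) s) pinit w) ->
     exists s1 s2 s3 s4 : seq (form S), w = sequent_word s1 s2 s3 s4) ->
  coNP_problem D (provable_words C).
Proof.
move=> hok ok_node hD.
have [R [CR RC]] := rule_list finite_calculus finitary_calculus.
have [Ll hL] := finite_list finite_Lambda.
pose L := closure Ll.
have L0 : Var 0 \in L := closure_Var0 _.
have hLam f : Lambda f -> f \in L.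
  by move=> /hL hf; apply: mem_closure hf (sub_refl f).
(* The same [K] serves for instantiating [L], which produces the search space, and for instantiating
   the rules over it. *)
have [K hK] := var_bound (L ++ flatten [seq [seq bf.2 | bf <- ac.1 ++ ac.2] | ac <- R]).
have LK f p : f \in L -> sub f (Var p) -> p < K.
  by move=> hf; apply: hK; rewrite mem_cat hf.
have RK ac bf p : ac \in R -> bf \in ac.1 ++ ac.2 -> sub bf.2 (Var p) -> p < K.
  move=> hac hbf; apply: hK; rewrite mem_cat; apply/orP; right.
  by apply/flatten_mapP; exists ac => //; apply: map_f.
have [M [c hM]] := machine_of_FP (FP_verify L K R hok).
have [d hd] := FP_size (FP_both_signs (FP_universe L K hok)).
(* The first summand bounds the certificate, which has one bit per signed formula of the search
   space and is thus no longer than the data listing them; the second bounds the running time. *)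
have [k hk] : pbound (fun n => poly_bound d (12 * n + 3) + poly_bound c n) by pb.
have hres x u : result M x u (poly_bound k (size x + size u)) =
    Some (verify L K R ok (input_data x u)).
  by apply: result_mono (hM x u); apply: leq_trans (hk _); apply: leq_addl.
exists M, k; split=> [x u _|x Dx]; first by rewrite hres.
have hacc u : (exists t, result M x u t = Some true) <-> verify L K R ok (input_data x u).
  split=> [[t ht]|hv]; first by have := result_det ht (hres x u) => <-.
  by exists (poly_bound k (size x + size u)); rewrite hres hv.
have [hval|hval] := boolP (valid (foldr (fun t s => pstep ok (dtok t) s) pinit x)); last first.
  split=> _.
    exists [::]; split=> //; apply/hacc.
    by rewrite /verify state_ofE (negbTE hval).
  split=> // -[Phi [_ /encodesP[s1 [s2 [s3 [s4 [e _]]]]] _]].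
  by rewrite e -(state_ofE _ _ [::]) valid_word in hval.
have [s1 [s2 [s3 [s4 ex]]]] := hD x Dx hval; rewrite {hval}ex in Dx hacc *.
set Phi := sequent s1 s2 s3 s4; set X := search_space L K s1 s2 s3 s4.
pose T := closure (s1 ++ s2 ++ s3 ++ s4).
have T0 : Var 0 \in T := closure_Var0 _.
have hT f : sub_stmt Phi f -> f \in T.
  case=> g hg; apply: mem_closure.
  by rewrite !mem_cat; case: hg => -[] /= ->; rewrite ?orbT.
have X0 : Var 0 \in X by apply: (insts_base L0 LK T0).
have Xsub : sub_closed X.
  by apply: insts_sub_closed => //; apply: closure_sub_closed.
have hX f : gensub Lambda Phi f -> f \in X by apply: insts_gensub.
have hv u : verify L K R ok (input_data (sequent_word s1 s2 s3 s4) u) <->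
    separates Phi (guessed L K ok s1 s2 s3 s4 u) /\
    closed_under R X K (guessed L K ok s1 s2 s3 s4 u).
  apply: iff_trans (refutesP L K R ok_node s1 s2 s3 s4 u).
  by rewrite /verify valid_word.
split.
  case=> _ hnp; have hnp' : ~ provable C Phi by move=> /provable_wordsP.
  have [|G [GX hsep hsat]] := unprovable_saturated (X := X) _ hnp'.
    move=> f hf; apply: hX; left; exists f; last exact: sub_refl.
    by case: hf => hf; [left; left | right; left].
  pose Y := [seq Cons (db true) (rep f) | f <- X] ++ [seq Cons (db false) (rep f) | f <- X].
  have eY u : both_signs (universe L K ok (input_data (sequent_word s1 s2 s3 s4) u)) = dl Y.
    by rewrite universe_word // /both_signs /dsign !dlK -!map_comp.
  pose q y := `[< exists b f, y = Cons (db b) (rep f) /\ G b f >].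
  (* The certificate is written backwards because the loader reverses it. *)
  exists (rev (map q Y)); split.
    rewrite size_rev size_map.
    have := hd (input_data (sequent_word s1 s2 s3 s4) [::]); rewrite eY => hs.
    apply: leq_trans (leq_trans (leq_addr _ _) (hk _)).
    apply: leq_trans (leq_trans hs _).
      by have := size_le_sz (dl Y); rewrite dlK.
    apply: leq_poly_bound => //.
    by have := sz_input_data (sequent_word s1 s2 s3 s4) [::]; rewrite addn0.
  apply/hacc/hv.
  have hG : guessed L K ok s1 s2 s3 s4 (rev (map q Y)) = G.
    apply: funext => b; apply: funext => f; apply: propext.
    rewrite /guessed /guess eY /= -map_rev revK -map_comp dmask_filter dlK.
    rewrite mem_rev mem_filter; split.
      by case/andP=> /asboolP[b' [f' [[/(can_inj dbK)-> /rep_inj->]]]].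
    move=> hf; apply/andP; split; first by apply/asboolP; exists b, f.
    by rewrite mem_cat; case: b hf => hf; rewrite (map_f _ (GX _ _ hf)) ?orbT.
  rewrite hG; split; first exact: hsep.
  have h := saturated_closed (K := K) RC GX hsat; exact: h.
case=> u [_ /hacc/hv[hsep hcl]]; split=> // /provable_wordsP.
apply: (@saturated_unprovable _ _ _ Lambda [set f | f \in X]) hsep _ => //.
have h := closed_saturated CR RK X0 Xsub hcl; exact: h.
Qed.
End Problem.

(* The second conjunct is the statement for words that need not be well formed:
   it is meaningful in general only if well-formedness is decidable, hence the
   restriction to finitely many connectives. *)
Theorem theorem4 (S : signature) (C : set (schema S)) (Lambda : set (form S))
    (finite_calculus : finite_set C)
    (finitary_calculus : forall r, C r -> finitary r)
    (finite_Lambda : finite_set Lambda)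
    (analytic_calculus : analytic Lambda C) :
  coNP_problem (bsequent_words S) (provable_words C) /\
  (finite_set [set: con S] -> coNP (provable_words C)).
Proof.
split=> [|/finite_seqP[cs hcs]].
  (* All instances of this problem are well formed, so arities need no check. *)
  apply: (@coNP_of_parser S C Lambda _ _ _ _ _ xpredT) => //.
    exact: FP_const (db true).
  move=> w [Phi [_ /encodesP[s1 [s2 [s3 [s4 [-> _]]]]]]] _.
  by exists s1, s2, s3, s4.
(* With finitely many connectives the arity check is a fixed finite disjunction over them. *)
pose arity_ok z := has (fun c : con S =>
  (hd z == dbits (pickle c)) && (size (undl (tl z)) == ar c)) cs.
apply: (@coNP_of_parser S C Lambda _ _ _ _ _ arity_ok) => //.
- apply: (@FP_has_seq _ cs (fun (c : con S) z =>
    (hd z == dbits (pickle c)) && (size (undl (tl z)) == ar c))) => c.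
  by apply: FP_and; [apply: FP_eq_const; fp | apply: FP_size_eq; fp].
- move=> c a; apply/hasP; exists c; last by rewrite /= dlK size_map size_enum_ord !eqxx.
  by have : [set: con S] c by []; rewrite hcs.
move=> w _; apply: run_valid => z /hasP[c _ /andP[/eqP h1 /eqP h2]].
by exists c.
Qed.
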